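(* Let $A$ be an $(n-2)\times n$ integer matrix of rank $n-2$ whose row space over $\mathbb{Q}$ contains $(1,\dots,1)$, so that $X_A\subset\mathbb{P}^{n-1}$ is a projective toric variety of codimension $2$, let $B$ be a Gale dual of $A$ with rows $b_1,\dots,b_n$, all nonzero, and let $P=\mathrm{Conv}(A)$. Let $\beta$ be a proper face of $P$, of codimension $r$, such that all rows of $B_\beta$ lie in one and the same relevant line. Let $v\in\mathbb{Z}^2$ be a primitive vector in this line, and for $i\in\mathfrak{I}_\beta$ write $b_i=\lambda_i v$ with $\lambda_i\in\mathbb{Z}$. Put $v_+^\beta=\{i\in\mathfrak{I}_\beta : \lambda_i>0\}$ and $v_-^\beta=\{i\in\mathfrak{I}_\beta:\lambda_i<0\}$. Then $$\mu(P,\beta)=\frac{\min\left(\sum_{i\in v_+^\beta}|\lambda_i|,\ \sum_{i\in v_-^\beta}|\lambda_i|\right)}{\gcd(\lambda_i)_{i\in\mathfrak{I}_\beta}}\qquad\text{and}\qquad i(P,\beta)=\gcd(\lambda_i)_{i\in\mathfrak{I}_\beta}.$$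
   Context: Notation. The columns of $A$ are $a_1,\dots,a_n\in\mathbb{Z}^{d}$, $d=n-2$; $P=\mathrm{Conv}(A)$ is the convex hull of the columns. $X_A\subset\mathbb{P}^{n-1}$ is the closure of the image of the monomial map $t\mapsto(t^{a_1}:\cdots:t^{a_n})$, $t\in(\mathbb{C}^* )^d$. A Gale dual of $A$ is an $n\times 2$ integer matrix $B$ whose columns form a $\mathbb{Z}$-basis of the kernel of $A:\mathbb{Z}^n\to\mathbb{Z}^{d}$ (image of $B$ equals kernel of $A$). Its rows are $b_1,\dots,b_n\in\mathbb{Z}^2$. Faces are understood to be nonempty. For a face $\alpha$ of $P$: $A_\alpha$ is the collection of columns $a_i$ of $A$ lying on $\alpha$; $\mathfrak{I}_\alpha=\{i: a_i\notin\alpha\}$; $B_\alpha$ is the collection (or matrix) of rows $b_i$ with $i\in\mathfrak{I}_\alpha$. $\mathbb{Z}\alpha$ is the subgroup of $\mathbb{Z}^d$ generated by $A_\alpha$, and $\mathbb{R}\alpha$ is the linear subspace of $\mathbb{R}^d$ spanned by $\alpha$. A line through $0$ in $\mathbb{R}^2$ is a relevant line if it contains two of the rows $b_r,b_s$ of $B$ pointing in opposite directions. An integer vector is primitive if it is not a non-trivial integer multiple of another integer vector. For faces $\beta\subset\alpha$ of $P$: $i(\alpha,\beta)$ is the index $[\mathbb{Z}\alpha\cap\mathbb{R}\beta:\mathbb{Z}\beta]$. The relative normalized subdiagram volume is $$\mu(\alpha,\beta)=\mathrm{Vol}(\mathrm{Conv}(A_\alpha/\beta))-\mathrm{Vol}(\mathrm{Conv}((A_\alpha/\beta)\setminus\{0\})),$$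 where $A_\alpha/\beta$ is the image of $A_\alpha$ in the quotient lattice $\mathbb{Z}\alpha/(\mathbb{Z}\alpha\cap\mathbb{R}\beta)$, which has rank $\dim\alpha-\dim\beta$, and $\mathrm{Vol}$ is the $(\dim\alpha-\dim\beta)$-dimensional volume normalized with respect to this quotient lattice (a unimodular simplex has volume $1$; the volume of a lower-dimensional or empty polytope is $0$, while a point in rank $0$ has volume $1$). *)

(* Defs.v *)
From HB Require Import structures.
From mathcomp Require Export all_boot all_order all_algebra finmap.
From mathcomp Require Export all_classical all_reals all_analysis.

Set Implicit Arguments.
Unset Strict Implicit.
Unset Printing Implicit Defensive.

Import Order.TTheory GRing.Theory Num.Theory.
Import numFieldNormedType.Exports.
Local Open Scope classical_set_scope.
Local Open Scope ring_scope.

Section Polytopes.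
Variable R : realType.

Definition conv (m : nat) (S : set 'cV[R]_m) : set 'cV[R]_m :=
  smallest (@convex_set R 'cV[R]_m) S.

Definition lin_span (m : nat) (S : set 'cV[R]_m) : set 'cV[R]_m :=
  [set x | exists (k : nat) (p : 'I_k -> 'cV[R]_m) (c : 'I_k -> R),
             (forall j, S (p j)) /\ x = \sum_(j < k) c j *: p j].

(* Lebesgue measure on R^m, computed by slicing along the first coordinate
   (Tonelli); meant for sets, such as polytopes, that are Borel. *)
Fixpoint leb (m : nat) : set 'cV[R]_m -> \bar R :=
  match m return set 'cV[R]_m -> \bar R with
  | 0 => fun S => (\1_S (0 : 'cV[R]_0))%:E
  | k.+1 => fun S =>
      (\int[lebesgue_measure]_(x in [set: R])
         leb [set y : 'cV[R]_k | S (col_mx (const_mx x : 'cV[R]_1) y)])%E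
  end.

(* Volume normalized with respect to Z^m: a unimodular simplex has volume 1. *)
Definition nvol (m : nat) (S : set 'cV[R]_m) : R := m`!%:R * fine (leb S).

Definition real_vec (m : nat) (x : 'cV[int]_m) : 'cV[R]_m := map_mx intr x.

End Polytopes.

Section Lattices.
Variable d : nat.

Definition cosets (L M : set 'cV[int]_d) : set (set 'cV[int]_d) :=
  [set C | exists2 x, L x & C = [set x + y | y in M]].

(* The index [L : M]; it is 0 by convention when it is infinite. *)
Definition lattice_index (L M : set 'cV[int]_d) : nat :=
  #|` fset_set (cosets L M)|%fset.

(* f induces an isomorphism of groups from L / K to Z^r. *)
Definition is_quotient_map (L K : set 'cV[int]_d) (r : nat)
    (f : 'cV[int]_d -> 'cV[int]_r) : Prop :=
  [/\ forall x y, L x -> L y -> f (x + y) = f x + f y,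
      f @` L = setT
    & forall x, L x -> (f x = 0 <-> K x)].

(* When L / K is free of rank r, some projection L -> L / K = Z^r. Two choices
   differ by an element of GL_r(Z), so volumes do not depend on it. *)
Definition quotient_map (L K : set 'cV[int]_d) (r : nat) :
    'cV[int]_d -> 'cV[int]_r :=
  xget (fun=> 0) [set f | is_quotient_map L K f].

End Lattices.

Arguments quotient_map {d} L K r.

Section Configuration.
Variables (R : realType) (d n : nat) (A : 'M[int]_(d, n)).

Definition polytope : set 'cV[R]_d :=
  conv [set x | exists i : 'I_n, x = real_vec R (col i A)].

(* Faces are the nonempty subsets of the polytope on which a linear form attains
   its maximum; the zero form yields the polytope itself. *)
Definition is_face (F : set 'cV[R]_d) : Prop :=
  F !=set0 /\
  exists (u : 'rV[R]_d) (c : R),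
    (forall x, polytope x -> (u *m x) 0 0 <= c) /\
    F = [set x | polytope x /\ (u *m x) 0 0 = c].

Definition cols_on (F : set 'cV[R]_d) : {set 'I_n} :=
  [set i | `[< F (real_vec R (col i A)) >]]%SET.

Definition cols_off (F : set 'cV[R]_d) : {set 'I_n} := (~: cols_on F)%SET.

(* Dimension of the affine hull of the columns lying on F. *)
Definition face_dim (F : set 'cV[R]_d) : nat :=
  (\rank (\sum_(i in cols_on F) \sum_(j in cols_on F)
            <<(real_vec R (col i A - col j A))^T>>)%MS)%N.

Definition Zspan (F : set 'cV[R]_d) : set 'cV[int]_d :=
  [set x | exists z : 'I_n -> int, x = \sum_(i in cols_on F) z i *: col i A].

(* The lattice points in the intersection of Zspan alpha with the linear span
   of beta. *)
Definition Zspan_sat (alpha beta : set 'cV[R]_d) : set 'cV[int]_d :=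
  [set x | Zspan alpha x /\ lin_span beta (real_vec R x)].

Definition face_index (alpha beta : set 'cV[R]_d) : nat :=
  lattice_index (Zspan_sat alpha beta) (Zspan beta).

Definition quotient_config (alpha beta : set 'cV[R]_d) :
    set 'cV[R]_(face_dim alpha - face_dim beta) :=
  [set y | exists2 i, i \in cols_on alpha &
     y = real_vec R (quotient_map (Zspan alpha) (Zspan_sat alpha beta)
                       (face_dim alpha - face_dim beta) (col i A))].
Arguments quotient_config alpha beta : clear implicits.

Definition subdiagram_volume (alpha beta : set 'cV[R]_d) : R :=
  nvol (conv (quotient_config alpha beta)) -
  nvol (conv (quotient_config alpha beta `\ 0)).

End Configuration.

Arguments polytope R {d n} A.
Arguments quotient_config {R d n} A alpha beta.

Definition is_gale_dual (d n : nat) (A : 'M[int]_(d, n)) (B : 'M[int]_(n, 2)) :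
    Prop :=
  (forall z : 'cV[int]_n, A *m z = 0 <-> exists w : 'cV[int]_2, z = B *m w) /\
  (forall w : 'cV[int]_2, B *m w = 0 -> w = 0).

Definition real_row (R : realType) (n : nat) (B : 'M[int]_(n, 2)) (i : 'I_n) :
    'rV[R]_2 := map_mx intr (row i B).

Definition is_line (R : realType) (ell : set 'rV[R]_2) : Prop :=
  exists2 u : 'rV[R]_2, u != 0 & ell = [set x | exists c : R, x = c *: u].

Definition opposite (R : realType) (x y : 'rV[R]_2) : Prop :=
  x != 0 /\ exists2 c : R, c < 0 & y = c *: x.

Definition relevant_line (R : realType) (n : nat) (B : 'M[int]_(n, 2))
    (ell : set 'rV[R]_2) : Prop :=
  is_line ell /\
  exists r s : 'I_n, [/\ ell (real_row R B r), ell (real_row R B s)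
                       & opposite (real_row R B r) (real_row R B s)].

(* In particular 0 is not primitive, since 0 = 0 *: w. *)
Definition primitive_vec (v : 'rV[int]_2) : Prop :=
  forall (k : int) (w : 'rV[int]_2), v = k *: w -> k = 1 \/ k = -1.

(* Main.v *)
From HB Require Import structures.
Require Import Defs.
From mathcomp Require Import measurable_realfun ring zify.
Import Order.TTheory GRing.Theory Num.Theory.
Import numFieldNormedType.Exports.
Local Open Scope classical_set_scope.
Local Open Scope ring_scope.

Set Implicit Arguments.
Unset Strict Implicit.
Unset Printing Implicit Defensive.

(** Let I be the set of columns off the face beta and put m = #|I|.  Gale duality
    identifies the lattice ZA spanned by the columns of A with Z^n modulo the image of B,
    and dividing by Z beta kills the coordinates outside I.  On I the rows of B are the
    multiples lambda_i v, and v is primitive, so v.w runs over all of Z: hence ZA / Z beta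
    is Z^I / Z lambda.  Write lambda = g l with g the gcd.  The torsion of that group is
    Z / g, generated by the class of l, and this is the index i(P, beta)
    ([face_index_eq]).  The free part Z^I / Z l has rank m - 1, which is the codimension
    of beta ([face_codim]), and A / beta consists of 0 and of the classes e_i of the unit
    vectors.

    The e_i are m vectors in rank m - 1 with the single relation sum_i l_i e_i = 0; as
    they generate the lattice, |l_i| is the determinant of the others
    ([quotient_minors]).  The slacks of the columns with respect to a supporting
    hyperplane of beta are positive on I and are orthogonal to l, so l has entries of
    both signs ([circuit_signs]).  Up to replacing l by its opposite, let
    sum_i l_i >= 0.  Adding multiples of l to the coefficients of a point of
    Conv(0, e_1, ..., e_m) until either a coefficient with l_i < 0 vanishes or the sum of
    the coefficients becomes 1 shows that the part of Conv(0, e) not in Conv(e) is tiled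
    by the simplices spanned by 0 and the e_j with j <> i, for l_i < 0
    ([conv0_minus]).  Their normalized volumes are the |l_i|, so the subdiagram volume is
    the sum of the |l_i| over l_i < 0, which is the smaller of the two sums
    ([circuit_volume]).

    Volumes are computed by iterated slicing, so the formula for the volume of a simplex
    in arbitrary lattice coordinates needs the linear change of variables.  The slicing
    function is shown to be a sigma-finite Borel measure ([leb_volE]), and the rule for
    invertible matrices follows by Gaussian elimination ([scales_unitmx]). *)

(** * Linear change of variables for Lebesgue measure *)

(** The measurability proof is part of the measure structure of a pushforward; hiding
    the structure behind an existential makes it usable where that proof cannot be
    inferred. *)
Lemma pushforward_measure d d' (T : measurableType d) (T' : measurableType d')
    (R : realType) (m : {measure set T -> \bar R}) (f : T -> T') :
  measurable_fun setT f ->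
  exists nu : {measure set T' -> \bar R}, forall A, nu A = m (f @^-1` A).
Proof.
move=> mf.
by unshelve refine (ex_intro _ (pushforward m f : {measure set T' -> \bar R}) _).
Qed.

Section LineSubstitution.
Variable R : realType.
Local Notation mu := (@lebesgue_measure R).

Lemma lebesgue_shift (t : R) (S : set (measurableTypeR R)) : measurable S ->
  mu [set x | S (x + t)] = mu S.
Proof.
move=> mS; pose f : measurableTypeR R -> measurableTypeR R := fun x => x + t.
have mf : measurable_fun setT f by apply: measurable_funD.
rewrite -[LHS]/(pushforward mu f S).
apply/esym/lebesgue_measure_unique => //= X /ocitvP[->|[[x y] /= xy ->]].
  by rewrite measure0 /pushforward preimage_set0 measure0.
rewrite /pushforward (_ : _ @^-1` _ = `]x - t, y - t]%classic).
  by rewrite !lebesgue_measure_itv /= !lte_fin xy ltrD2r xy -!EFinB; congr EFin; ring.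
apply/seteqP; split => z /=; rewrite !in_itv /= /f ltrBlDr lerBrDr //.
Qed.

Lemma lebesgue_scale (a : R) (S : set (measurableTypeR R)) : a != 0 -> measurable S ->
  mu [set x | S (a * x)] = (`|a|^-1%:E * mu S)%E.
Proof.
move=> a0 mS; pose f : measurableTypeR R -> measurableTypeR R := fun x => a * x.
have mf : measurable_fun setT f by apply: measurable_funM.
suff E : mu S = (`|a|%:E * mu [set x | S (a * x)%R])%E.
  have a1 : (`|a|^-1 * `|a| = 1)%R by rewrite mulVf // normr_eq0.
  by rewrite E muleA -EFinM a1 mul1e.
have [nu nuE] : exists nu : {measure set (measurableTypeR R) -> \bar R},
  forall A, nu A = mu (f @^-1` A) := pushforward_measure mu mf.
rewrite -[X in (_ * X)%E](nuE S) -[RHS]/(mscale (NngNum (normr_ge0 a)) nu S).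
apply: lebesgue_measure_unique => //= X /ocitvP[->|[[x y] /= xy ->]].
  by rewrite !measure0.
rewrite /mscale /= nuE.
have [a_gt0|a_lt0|a00] := ltrgt0P a; last by rewrite a00 eqxx in a0.
- have -> : f @^-1` `]x, y] = `]x / a, y / a]%classic.
    by apply/seteqP; split => z /=; rewrite !in_itv /= /f ltr_pdivrMr // ler_pdivlMr // mulrC.
  have -> := lebesgue_measure_itv `]x / a, y / a].
  rewrite lebesgue_measure_itv /= !lte_fin xy ltr_pM2r ?invr_gt0 // xy -!EFinB -EFinM.
  by congr EFin; field.
- have -> : f @^-1` `]x, y] = `[y / a, x / a[%classic.
    apply/seteqP; split => z /=; rewrite !in_itv /= /f ltr_ndivlMr // ler_ndivrMr // mulrC;
      by case/andP => -> ->.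
  have -> := lebesgue_measure_itv `[y / a, x / a[.
  rewrite lebesgue_measure_itv /= !lte_fin xy ltr_nM2r ?invr_lt0 // xy -!EFinB -EFinM.
  by congr EFin; field.
Qed.

End LineSubstitution.

(** Stated with preimages rather than images, so that no inverse map is needed; the
    ratio of an invertible matrix is then the inverse of its determinant. *)
Definition scales d (T : measurableType d) (R : realType) (mu : set T -> \bar R)
    (c : R) (phi : T -> T) :=
  forall S, measurable S -> mu (phi @^-1` S) = (c%:E * mu S)%E.

Section ProductScaling.
Context d1 d2 (T1 : measurableType d1) (T2 : measurableType d2) (R : realType).
Variables (mu1 : {sigma_finite_measure set T1 -> \bar R})
  (mu2 : {sigma_finite_measure set T2 -> \bar R}).

Lemma ge0_integral_scales d (T : measurableType d) (mu : {measure set T -> \bar R})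
    (phi : T -> T) (c : R) (f : T -> \bar R) :
  measurable_fun setT phi -> 0 <= c -> scales mu c phi ->
  measurable_fun setT f -> (forall x, 0 <= f x)%E ->
  (\int[mu]_x f (phi x) = c%:E * \int[mu]_x f x)%E.
Proof.
move=> mphi c0 phiE mf f0.
have /= <- := ge0_integral_pushforward mphi mu measurableT mf (fun y _ => f0 y).
have /= <- := ge0_integral_mscale mu measurableT (NngNum c0) mf (fun y _ => f0 y).
have [nu nuE] := pushforward_measure mu mphi.
transitivity (\int[nu]_y f y)%E.
  by congr integral; apply/funext => A; rewrite nuE.
by apply: eq_measure_integral => A mA _; rewrite nuE /mscale /= phiE.
Qed.

Lemma product_measure_sym (S : set (T1 * T2)) : measurable S ->
  (mu1 \x mu2)%E S = (mu1 \x^ mu2)%E S.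
Proof.
move=> mS; have := indic_fubini_tonelli mu1 mu2 mS.
by rewrite indic_fubini_tonelli_FE // indic_fubini_tonelli_GE.
Qed.

(** Fubini on the slices of the first factor: each slice of the preimage is the preimage
    of a slice. *)
Lemma scales_skew1 (phi : T1 -> T1) (psi : T1 -> T2 -> T2) (c1 c2 : R) :
  measurable_fun setT phi -> 0 <= c1 -> scales mu1 c1 phi ->
  0 <= c2 -> (forall x, scales mu2 c2 (psi x)) ->
  scales (mu1 \x mu2)%E (c1 * c2) (fun p => (phi p.1, psi p.1 p.2)).
Proof.
move=> mphi c10 phiE c20 psiE S mS; rewrite /product_measure1.
transitivity (\int[mu1]_x (c2%:E * mu2 (xsection S (phi x))))%E.
  apply: eq_integral => x _ /=; rewrite -(psiE x); last exact: measurable_xsection.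
  by congr (mu2 _); apply/seteqP; split => y /=; rewrite !xsectionE.
have mf : measurable_fun setT (mu2 \o xsection S) by exact: measurable_fun_xsection.
rewrite ge0_integralZl //; last exact: (measurableT_comp mf mphi).
rewrite (@ge0_integral_scales _ _ mu1 phi c1 (mu2 \o xsection S)) //.
by rewrite muleA -EFinM mulrC.
Qed.

(** The mirror image of [scales_skew1]; since the product measure integrates along the
    first factor, this is where Tonelli is used. *)
Lemma scales_skew2 (phi : T2 -> T1 -> T1) (psi : T2 -> T2) (c1 c2 : R) :
  measurable_fun setT (fun p : T1 * T2 => (phi p.2 p.1, psi p.2)) ->
  measurable_fun setT psi -> 0 <= c2 -> scales mu2 c2 psi ->
  0 <= c1 -> (forall y, scales mu1 c1 (phi y)) ->
  scales (mu1 \x mu2)%E (c1 * c2) (fun p => (phi p.2 p.1, psi p.2)).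
Proof.
move=> mP mpsi c20 psiE c10 phiE S mS; rewrite !product_measure_sym //; last first.
  by rewrite -[X in measurable X]setTI; exact: mP.
rewrite /product_measure2.
transitivity (\int[mu2]_y (c1%:E * mu1 (ysection S (psi y))))%E.
  apply: eq_integral => y _ /=; rewrite -(phiE y); last exact: measurable_ysection.
  by congr (mu1 _); apply/seteqP; split => x /=; rewrite !ysectionE.
have mf : measurable_fun setT (mu1 \o ysection S) by exact: measurable_fun_ysection.
rewrite ge0_integralZl //; last exact: (measurableT_comp mf mpsi).
rewrite (@ge0_integral_scales _ _ mu2 psi c2 (mu1 \o ysection S)) //.
by rewrite muleA -EFinM.
Qed.
End ProductScaling.

Section Borel.
Variable R : realType.

(** A copy of the column vectors that carries the Borel structure generated by the
    coordinates. *)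
Definition vec (k : nat) : Type := 'cV[R]_k.
HB.instance Definition _ k := Pointed.on (vec k).

Definition coords k : 'I_k -> vec k -> R := fun i x => (x : 'cV[R]_k) i 0.

Lemma coords_set0 k : g_sigma_preimage (@coords k) set0.
Proof. exact: sigma_algebra0. Qed.
Lemma coords_setC k A :
  g_sigma_preimage (@coords k) A -> g_sigma_preimage (@coords k) (~` A).
Proof. exact: sigma_algebraC. Qed.
Lemma coords_bigcup k (F : (set (vec k))^nat) :
  (forall i, g_sigma_preimage (@coords k) (F i)) ->
  g_sigma_preimage (@coords k) (\bigcup_i (F i)).
Proof. exact: sigma_algebra_bigcup. Qed.

Definition vec_display : measure_display. Proof. exact: default_measure_display. Qed.

HB.instance Definition _ k := @isMeasurable.Build vec_display
  (vec k) (g_sigma_preimage (@coords k)) (@coords_set0 k) (@coords_setC k) (@coords_bigcup k).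

Lemma measurable_coord k (i : 'I_k) : measurable_fun [set: vec k] (coords i).
Proof.
move=> _ Y mY; rewrite setTI; apply: sub_sigma_algebra => /=.
rewrite -bigcup_seq/=; exists i => /=; first by rewrite mem_index_enum.
by exists Y => //; rewrite setTI.
Qed.

Lemma measurable_coordP d (T : measurableType d) k (f : T -> vec k) :
  (forall i, measurable_fun [set: T] (fun x => coords i (f x))) ->
  measurable_fun [set: T] f.
Proof.
move=> mf _ A mA; rewrite setTI.
suff pS : g_sigma_preimage (fun i => @coords k i \o f) `<=` measurable.
  by apply: pS; rewrite g_sigma_preimage_comp; exists A; rewrite ?setTI.
apply: smallest_sub; first exact: sigma_algebra_measurable.
case: k => [|k] in f mf A mA *; first by rewrite big_ord0.
rewrite -bigcup_mkord_ord; apply: bigcup_sub => i Ii.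
by move=> B [C mC <-]; exact: mf.
Qed.

Lemma measurable_affine k l (M : 'M[R]_(l, k)) (b : 'cV[R]_l) :
  measurable_fun [set: vec k] (fun x : vec k => M *m x + b : vec l).
Proof.
apply: measurable_coordP => i; rewrite /coords.
rewrite (_ : (fun _ => _) = fun x => \sum_j (M i j * coords j x) + b i 0); last first.
  by apply/funext => x; rewrite !mxE.
apply: measurable_funD => //; apply: measurable_sum => j.
by apply: measurable_funM => //; exact: measurable_coord.
Qed.

(** The splitting of R^(1 + k) along which [leb] slices. *)
Definition glue k (p : measurableTypeR R * vec k) : vec k.+1 :=
  col_mx (const_mx p.1 : 'cV[R]_1) (p.2 : 'cV[R]_k).
Definition unglue k (x : vec k.+1) : measurableTypeR R * vec k :=
  ((x : 'cV[R]_(1 + k)) 0 0, dsubmx (x : 'cV[R]_(1 + k))).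

Lemma unglueK k : cancel (@unglue k) (@glue k).
Proof.
move=> x; pose y : 'cV[R]_(1 + k) := x.
transitivity (col_mx (usubmx y) (dsubmx y)); last exact: (vsubmxK y).
rewrite /glue /unglue /= (_ : const_mx _ = usubmx (x : 'cV[R]_(1 + k))) //.
by apply/matrixP => i j; rewrite !mxE !ord1; congr (x _ _); apply/val_inj.
Qed.

Lemma glueK k : cancel (@glue k) (@unglue k).
Proof.
move=> [x y]; rewrite /glue /unglue /= col_mxKd; congr pair.
transitivity (col_mx (const_mx x : 'cV[R]_1) (y : 'cV[R]_k) (lshift k 0) 0).
  by congr (fun_of_matrix _ _ _); apply/val_inj.
by rewrite col_mxEu mxE.
Qed.

Lemma glueD k (p q : measurableTypeR R * vec k) :
  (glue p : 'cV[R]_(1 + k)) + glue q =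
  glue (p.1 + q.1, (p.2 : 'cV[R]_k) + (q.2 : 'cV[R]_k)).
Proof.
rewrite /glue add_col_mx /= (_ : const_mx _ + _ = const_mx (p.1 + q.1)) //.
by apply/matrixP => i j; rewrite !mxE.
Qed.

Lemma mul_block_glue k (a : R) (b : 'rV[R]_k) (c : 'cV[R]_k) (D : 'M[R]_k)
    (p : measurableTypeR R * vec k) :
  block_mx a%:M b c D *m glue p =
  glue (a * p.1 + (b *m p.2) 0 0, p.1 *: c + (D *m p.2)).
Proof.
rewrite /glue mul_block_col /= (_ : _ + b *m _ = const_mx (a * p.1 + (b *m p.2) 0 0)).
  rewrite (_ : c *m _ = p.1 *: c) //.
  by apply/matrixP => i j; rewrite !mxE big_ord1 !mxE mulrC !ord1.
apply/matrixP => i j; rewrite !ord1 [RHS]mxE [LHS]mxE; congr (_ + _).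
by rewrite !mxE big_ord1 !mxE eqxx mulr1n.
Qed.

Lemma measurable_glue k : measurable_fun setT (@glue k).
Proof.
apply: measurable_coordP => i; rewrite /coords /glue.
have -> : i = unsplit (@fintype.split 1 k i) by rewrite fintype.splitK.
case: (fintype.split _) => j /=.
  rewrite (_ : (fun _ => _) = fst); first exact: measurable_fst.
  by apply/funext => x; rewrite (@col_mxEu _ 1 k) mxE.
rewrite (_ : (fun _ => _) = coords j \o snd).
  by apply: measurableT_comp; [exact: measurable_coord|exact: measurable_snd].
by apply/funext => x; rewrite (@col_mxEd _ 1 k).
Qed.

Lemma measurable_unglue k : measurable_fun setT (@unglue k).
Proof.
apply: measurable_fun_pair; first exact: (@measurable_coord k.+1).
apply: measurable_coordP => i.
rewrite (_ : (fun _ => _) = @coords k.+1 (@rshift 1 k i)); first exact: measurable_coord.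
by apply/funext => x; rewrite /coords mxE.
Qed.
End Borel.

Section GlueMeasure.
Variables (R : realType) (k : nat) (mu : {sigma_finite_measure set (vec R k) -> \bar R}).
Local Notation leb1 := (@lebesgue_measure R).

(** The inductive step of the slicing definition of volume, as a measure. *)
Definition glue_measure (S : set (vec R k.+1)) : \bar R :=
  (leb1 \x mu)%E (@glue R k @^-1` S).

Let measurable_glue_preimage (S : set (vec R k.+1)) :
  measurable S -> measurable (@glue R k @^-1` S).
Proof. by move=> mS; rewrite -[X in measurable X]setTI; exact: measurable_glue. Qed.

Let glue_measure0 : glue_measure set0 = 0%E.
Proof. by rewrite /glue_measure preimage_set0 measure0. Qed.
Let glue_measure_ge0 S : (0 <= glue_measure S)%E.
Proof. exact: measure_ge0. Qed.
Let glue_measure_sigma_additive : semi_sigma_additive glue_measure.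
Proof.
move=> F mF tF mUF; rewrite /glue_measure preimage_bigcup.
apply: measure_semi_sigma_additive.
- by move=> n; exact: measurable_glue_preimage.
- apply/trivIsetP => /= i j _ _ ij; rewrite -preimage_setI.
  by move/trivIsetP : tF => /(_ _ _ _ _ ij) ->//; rewrite preimage_set0.
- by rewrite -preimage_bigcup; exact: measurable_glue_preimage.
Qed.
HB.instance Definition _ := isMeasure.Build _ _ _ glue_measure
  glue_measure0 glue_measure_ge0 glue_measure_sigma_additive.

Let glue_measure_sigma_finite : sigma_finite setT glue_measure.
Proof.
have /sigma_finiteP[F [TF ndF Foo]] := sigma_finiteT leb1.
have /sigma_finiteP[G [TG ndG Goo]] := sigma_finiteT mu.
exists (fun n => @unglue R k @^-1` (F n `*` G n)).
  rewrite -preimage_bigcup (_ : \bigcup_n (F n `*` G n) = setT) ?preimage_setT //.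
  apply/seteqP; split => // -[x y] _.
  have [n _ Fn] : (\bigcup_i F i) x by rewrite -TF.
  have [m _ Gm] : (\bigcup_i G i) y by rewrite -TG.
  exists (maxn n m) => //; split => /=.
  - by move: x Fn; exact/subsetPset/ndF/leq_maxl.
  - by move: y Gm; exact/subsetPset/ndG/leq_maxr.
move=> n; have [mF Fn] := Foo n; have [mG Gn] := Goo n; split.
  by rewrite -[X in measurable X]setTI; apply: measurable_unglue => //; exact: measurableX.
rewrite /glue_measure -comp_preimage (_ : _ \o _ = id); last by apply/funext => p; exact: glueK.
by rewrite preimage_id product_measure1E // lte_mul_pinfty // ge0_fin_numE.
Qed.
HB.instance Definition _ := Measure_isSigmaFinite.Build _ _ _ glue_measure
  glue_measure_sigma_finite.
End GlueMeasure.

Section Volume.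
Variable R : realType.

Fixpoint vol k : {sigma_finite_measure set (vec R k) -> \bar R} :=
  match k with
  | 0 => \d_((0 : 'cV[R]_0) : vec R 0)
  | k'.+1 => glue_measure (vol k')
  end.

(** On Borel sets the slicing function is a measure; all additivity and Tonelli
    arguments go through [vol]. *)
Lemma leb_volE k (S : set (vec R k)) : measurable S -> leb S = vol k S.
Proof.
elim: k S => [|k IH] S mS; first by rewrite /= diracE indicE.
rewrite [RHS]/= /glue_measure /product_measure1 [LHS]/=.
apply: eq_integral => x _; rewrite /= -IH.
  by congr leb; apply/seteqP; split => y /=; rewrite xsectionE.
apply: measurable_xsection; rewrite -[X in measurable X]setTI; exact: measurable_glue.
Qed.

Lemma vol_glue k c (phi : vec R k.+1 -> vec R k.+1)
   (psi : measurableTypeR R * vec R k -> measurableTypeR R * vec R k) :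
  (forall p, phi (glue p) = glue (psi p)) ->
  scales (@lebesgue_measure R \x vol k)%E c psi -> scales (vol k.+1) c phi.
Proof.
move=> E sc S mS; rewrite /= /glue_measure -sc.
  by congr product_measure1; apply/funext => p /=; rewrite E.
by rewrite -[X in measurable X]setTI; exact: measurable_glue.
Qed.

Lemma vol_shift k (b : 'cV[R]_k) : scales (vol k) 1 (fun x : vec R k => x + b).
Proof.
elim: k b => [|k IH] b S mS.
  rewrite mul1e (_ : (fun x : vec R 0 => _) = id) //.
  by apply/funext => x; rewrite [LHS]flatmx0 [RHS]flatmx0.
pose psi (p : measurableTypeR R * vec R k) : measurableTypeR R * vec R k :=
  (p.1 + (b : 'cV_(1 + k)) 0 0, p.2 + dsubmx (b : 'cV_(1 + k))).
apply: (@vol_glue _ _ _ psi) => //.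
  by move=> p; rewrite -{1}(unglueK b) glueD.
rewrite -[1]mul1r; apply: (@scales_skew1 _ _ _ _ _ _ _
  (fun x : measurableTypeR R => x + (b : 'cV_(1 + k)) 0 0 : measurableTypeR R)
  (fun _ (y : vec R k) => (y : 'cV[R]_k) + dsubmx (b : 'cV_(1 + k)))) => //.
  exact: measurable_funD.
by move=> X mX; rewrite mul1e; exact: lebesgue_shift.
Qed.

Lemma scales_mul (k : nat) (M N : 'M[R]_k) (a b : R) :
  scales (vol k) a (mulmx M : vec R k -> vec R k) ->
  scales (vol k) b (mulmx N : vec R k -> vec R k) ->
  scales (vol k) (b * a) (mulmx (M *m N) : vec R k -> vec R k).
Proof.
move=> sM sN S mS.
rewrite EFinM -muleA -sM // -sN; last first.
  rewrite -[X in measurable X]setTI.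
  have := @measurable_affine R k k M 0; rewrite (_ : (fun _ => _) = mulmx M); first exact.
  by apply/funext => x; rewrite addr0.
by congr (vol k _); apply/seteqP; split => x /=; rewrite mulmxA.
Qed.

(** Slices along the first coordinate are translated. *)
Lemma scales_lower k (c : 'cV[R]_k) :
  scales (vol k.+1) 1
    (mulmx (block_mx 1%:M 0 c 1%:M : 'M[R]_(1 + k)) : vec R k.+1 -> vec R k.+1).
Proof.
pose psi (p : measurableTypeR R * vec R k) : measurableTypeR R * vec R k :=
  (id p.1, (p.2 : 'cV[R]_k) + p.1 *: c).
apply: (@vol_glue _ _ _ psi) => //.
  by move=> p; rewrite mul_block_glue mul1r mul0mx mxE addr0 mul1mx addrC.
rewrite -[1]mul1r; apply: (@scales_skew1 _ _ _ _ _ lebesgue_measure (vol k) id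
  (fun (x : measurableTypeR R) (y : vec R k) => (y : 'cV[R]_k) + x *: c)) => //.
- by move=> X mX; rewrite mul1e.
- by move=> x; exact: vol_shift.
Qed.

(** Lines parallel to the first axis are translated along themselves. *)
Lemma scales_upper k (b : 'rV[R]_k) :
  scales (vol k.+1) 1
    (mulmx (block_mx 1%:M b 0 1%:M : 'M[R]_(1 + k)) : vec R k.+1 -> vec R k.+1).
Proof.
pose phi (y : vec R k) (x : measurableTypeR R) : measurableTypeR R := x + (b *m y) 0 0.
apply: (@vol_glue _ _ _ (fun p => (phi p.2 p.1, id p.2))) => //.
  by move=> p; rewrite mul_block_glue mul1r mul1mx scaler0 add0r.
rewrite -[1]mul1r; apply: (@scales_skew2 _ _ _ _ _ lebesgue_measure (vol k) phi id) => //.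
- apply: measurable_fun_pair; last exact: measurable_snd.
  apply: measurable_funD; first exact: measurable_fst.
  rewrite (_ : (fun _ => _) = (fun y : vec R k => coords 0 (b *m y + 0 : vec R 1)) \o snd).
    apply: measurableT_comp; last exact: measurable_snd.
    by apply: (measurableT_comp (@measurable_coord R 1 0)); exact: measurable_affine.
  by apply/funext => p; rewrite /= addr0.
- by move=> X mX; rewrite mul1e.
- by move=> y X mX; rewrite mul1e; exact: lebesgue_shift.
Qed.

Lemma scales_diag k (a c : R) (D : 'M[R]_k) : a != 0 -> 0 <= c ->
  scales (vol k) c (mulmx D : vec R k -> vec R k) ->
  scales (vol k.+1) (`|a|^-1 * c)
    (mulmx (block_mx a%:M 0 0 D : 'M[R]_(1 + k)) : vec R k.+1 -> vec R k.+1).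
Proof.
move=> a0 c0 sD.
apply: (@vol_glue _ _ _ (fun p => (a * p.1, D *m p.2 : vec R k))) => //.
  by move=> p; rewrite mul_block_glue mul0mx mxE addr0 scaler0 add0r.
apply: (@scales_skew1 _ _ _ _ _ lebesgue_measure (vol k)
  (fun x : measurableTypeR R => a * x : measurableTypeR R)
  (fun _ => mulmx D : vec R k -> vec R k)) => //.
- exact: measurable_funM.
- by move=> X mX; exact: lebesgue_scale.
Qed.

(** Gaussian elimination by induction on the size. With a nonzero corner entry a matrix
    is the product of a lower shear, a block diagonal matrix and an upper shear. If the
    corner vanishes, an upper shear first moves a nonzero entry of the first column into
    it. *)
Lemma scales_unitmx k (M : 'M[R]_k) : M \in unitmx ->
  scales (vol k) `|\det M|^-1 (mulmx M : vec R k -> vec R k).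
Proof.
elim: k M => [|k IH] M uM.
  move=> S mS; rewrite det_mx00 normr1 invr1 mul1e (_ : mulmx M = id) //.
  by apply/funext => x; rewrite [LHS]flatmx0 [RHS]flatmx0.
have pivot (N : 'M[R]_(1 + k)) : N \in unitmx -> N 0 0 != 0 ->
    scales (vol k.+1) `|\det N|^-1 (mulmx N : vec R k.+1 -> vec R k.+1).
  move=> uN a0; set a := N 0 0 in a0.
  (* D is the Schur complement of the corner entry. *)
  pose b := ursubmx N; pose c := dlsubmx N; pose D := drsubmx N - a^-1 *: (c *m b).
  have NE : N = block_mx 1%:M 0 (a^-1 *: c) 1%:M *m
      (block_mx a%:M 0 0 D *m block_mx 1%:M (a^-1 *: b) 0 1%:M).
    rewrite !mulmx_block !(mul0mx, mulmx0, mul1mx, mulmx1, addr0, add0r).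
    have aV : a * a^-1 = 1 by rewrite mulfV.
    rewrite !mul_scalar_mx !mul_mx_scalar !scalerA aV !scale1r.
    rewrite -scalemxAl /D addrC subrK -[LHS]submxK; congr block_mx.
    by apply/matrixP => i j; rewrite !ord1 !mxE eqxx mulr1n; congr (N _ _); apply/val_inj.
  have detN : \det N = a * \det D.
    by rewrite NE !det_mulmx det_lblock det_ublock det_ublock !det1 det_scalar1 !mul1r !mulr1.
  have uD : D \in unitmx.
    by move: uN; rewrite !unitmxE detN !unitfE mulf_eq0 negb_or => /andP[].
  have := scales_mul (scales_lower (a^-1 *: c))
    (scales_mul (scales_diag a0 _ (IH D uD)) (scales_upper (a^-1 *: b))).
  rewrite mul1r mulr1 -NE detN normrM invfM; apply.
  by rewrite invr_ge0.
have [M00|M00] := eqVneq ((M : 'M[R]_(1 + k)) 0 0) 0; last exact: pivot.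
have [i Mi] : exists i, dlsubmx (M : 'M[R]_(1 + k)) i 0 != 0.
  apply/existsP; apply: contraLR uM => /existsPn M0.
  rewrite unitmxE unitfE negbK -det_tr; apply/eqP.
  rewrite (expand_det_row _ ord0) big1 // => i _; rewrite mxE.
  suff -> : M i ord0 = 0 by rewrite mul0r.
  case: (fintype.unliftP ord0 i) => [j ->|->]; last exact: M00.
  move: (M0 j); rewrite negbK !mxE => /eqP <-; congr (M _ _); exact/val_inj.
pose b : 'rV[R]_k := delta_mx 0 i.
pose N : 'M[R]_(1 + k) := block_mx 1%:M b 0 1%:M *m (M : 'M[R]_(1 + k)).
have N00 : N 0 0 != 0.
  rewrite (_ : N 0 0 = (M : 'M[R]_(1 + k)) 0 0 + dlsubmx (M : 'M[R]_(1 + k)) i 0).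
    by rewrite M00 add0r.
  rewrite /N -{1}(submxK (M : 'M[R]_(1 + k))) mulmx_block mul1mx.
  have -> : (0 : 'I_(1 + k)) = lshift k 0 by apply/val_inj.
  rewrite block_mxEul mxE -rowE; congr (_ + _); last by rewrite mxE.
  by rewrite !mxE.
have ME : M = block_mx 1%:M (- b) 0 1%:M *m N :> 'M[R]_(1 + k).
  rewrite mulmxA mulmx_block !(mul0mx, mulmx0, mul1mx, mulmx1, addr0, add0r) subrr.
  by rewrite -scalar_mx_block mul1mx.
have detN : \det N = \det M by rewrite det_mulmx det_ublock !det1 !mul1r.
have uN : N \in unitmx by rewrite unitmxE detN -unitmxE.
have := scales_mul (scales_upper (- b)) (pivot N uN N00).
by rewrite -ME detN mulr1.
Qed.
End Volume.

(** * Volumes of coordinate simplices *)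

Section Simplex.
Variable R : realType.

(** The booleans choose between strict and weak inequalities: the volume does not depend
    on them, while half-open simplices can be made disjoint. *)
Definition corner k (s : 'I_k -> bool) (b : bool) (t : R) : set (vec R k) :=
  [set c : 'cV[R]_k | (forall i, 0 < c i 0 ?<= if s i) /\ \sum_i c i 0 < t ?<= if b].

Lemma glue_head k (p : measurableTypeR R * vec R k) : fun_of_matrix (glue p) ord0 0 = p.1.
Proof. by rewrite -[in RHS](glueK p) /=; congr (fun_of_matrix _ _ _); apply/val_inj. Qed.

Lemma glue_tail k (p : measurableTypeR R * vec R k) (i : 'I_k) :
  fun_of_matrix (glue p) (lift ord0 i) 0 = fun_of_matrix p.2 i 0.
Proof.
transitivity (col_mx (const_mx p.1 : 'cV[R]_1) (p.2 : 'cV[R]_k) (rshift 1 i) 0).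
  by congr (fun_of_matrix _ _ _); exact/val_inj.
by rewrite col_mxEd.
Qed.

Lemma corner_glue k (s : 'I_k.+1 -> bool) b t (p : measurableTypeR R * vec R k) :
  corner s b t (glue p) <->
  (0 < p.1 ?<= if s ord0) /\ corner (s \o lift ord0) b (t - p.1) p.2.
Proof.
rewrite /corner /= big_ord_recl glue_head (eq_bigr _ (fun i _ => glue_tail p i)).
rewrite lteifBrDl; split=> [[s0 st]|[p0 [s0 st]]]; split => //.
- by rewrite -(glue_head p); exact: s0.
- by split=> // i; rewrite -glue_tail.
- move=> i; case: (fintype.unliftP ord0 i) => [j ->|->]; last by rewrite glue_head.
  by rewrite glue_tail; exact: s0.
Qed.

Lemma measurable_halfspace k (a : 'rV[R]_k) (b : R) (c : bool) :
  measurable [set x : vec R k | b < (a *m x) 0 0 ?<= if c].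
Proof.
have mf : measurable_fun setT (fun x : vec R k => (a *m x) 0 0).
  rewrite (_ : (fun _ => _) = (fun x : vec R k => coords 0 (a *m x + 0 : vec R 1))).
    by apply: (measurableT_comp (@measurable_coord R 1 0)); exact: measurable_affine.
  by apply/funext => p; rewrite /= addr0.
have mle (f g : vec R k -> R) : measurable_fun setT f -> measurable_fun setT g ->
    measurable [set x | f x <= g x].
  by move=> mf' mg; rewrite -[X in measurable X]setTI; exact: measurable_fun_le.
case: c => /=; first exact: mle.
rewrite (_ : [set _ | _] = ~` [set x : vec R k | (a *m x) 0 0 <= b]).
  by apply: measurableC; exact: mle.
by apply/seteqP; split => x /=; rewrite ltNge => /negP.
Qed.

Lemma measurable_corner k (s : 'I_k -> bool) b t : measurable (corner s b t).
Proof.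
rewrite (_ : corner s b t = (\bigcap_(i in setT)
      [set c : vec R k | 0 < ((delta_mx 0 i : 'rV[R]_k) *m c) 0 0 ?<= if s i])
   `&` [set c : vec R k | - t < ((const_mx (-1) : 'rV[R]_k) *m c) 0 0 ?<= if b]).
  apply: measurableI; last exact: measurable_halfspace.
  apply: fin_bigcap_measurable; first exact: finite_finset.
  by move=> i _; exact: measurable_halfspace.
have sumE (c : 'cV[R]_k) : (const_mx (-1) *m c : 'M[R]_1) 0 0 = - \sum_i c i 0.
  by rewrite mxE -sumrN; apply: eq_bigr => i _; rewrite mxE mulN1r.
apply/seteqP; split => c; rewrite /corner /= sumE lteifN2.
  by case=> s0 st; split=> // i _; rewrite /= -rowE mxE.
by case=> s0 st; split=> // i; have := s0 i I; rewrite /= -rowE mxE.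
Qed.

Lemma lteif_pMr (b : bool) (a x : R) : 0 < a -> (0 < a * x ?<= if b) = (0 < x ?<= if b).
Proof. by move=> a0; rewrite -{1}(mulr0 a) lteif_pM2l. Qed.

Lemma vol_corner_scale k (s : 'I_k -> bool) t : 0 < t ->
  vol R k (corner s false t) = ((t ^+ k)%:E * vol R k (corner s false 1))%E.
Proof.
move=> t0; have /scales_unitmx /(_ _ (measurable_corner s false 1)) : (t^-1%:M : 'M[R]_k) \in unitmx.
  by rewrite unitmxE det_scalar unitfE expf_neq0 // invr_neq0 // gt_eqF.
rewrite det_scalar normrX normfV exprVn invrK gtr0_norm // => <-.
congr (vol R k _); apply/seteqP; split => c; rewrite /corner /= => -[s0 st]; split.
- by move=> i; rewrite mul_scalar_mx mxE lteif_pMr // invr_gt0.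
- under eq_bigr do rewrite mul_scalar_mx mxE.
  by rewrite -mulr_sumr mulrC ltr_pdivrMr // mul1r.
- by move=> i; have := s0 i; rewrite mul_scalar_mx mxE lteif_pMr // invr_gt0.
- move: st; under eq_bigr do rewrite mul_scalar_mx mxE.
  by rewrite -mulr_sumr mulrC ltr_pdivrMr // mul1r.
Qed.

(** The slice at x is the simplex of size 1 - x in one dimension less, so the factor
    gained is the integral of (1 - x)^k over [0, 1]. *)
Lemma vol_corner1 k (s : 'I_k -> bool) : vol R k (corner s false 1) = (k`!%:R^-1)%:E.
Proof.
elim: k s => [|k IH] s.
  rewrite fact0 invr1 /= diracE mem_set // /corner /= big_ord0; split => //.
  by case.
rewrite /= /glue_measure /product_measure1.
pose D := [set` Interval (BSide (s ord0) (0 : R)) (BLeft 1)].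
transitivity (\int[lebesgue_measure]_(x in D) ((k`!%:R^-1)%:E * ((1 - x) ^+ k)%:E))%E.
  rewrite [RHS]integral_mkcond; apply: eq_integral => x _; rewrite patchE.
  case: ifPn => [|xD].
    rewrite inE /D /= => xD.
    have [x0 x1] : (0 < x ?<= if s ord0) /\ x < 1.
      by move: xD; rewrite /= itv_boundlr /=; case: (s ord0) => /andP[].
    rewrite muleC -(IH (s \o lift ord0)) -vol_corner_scale ?subr_gt0 //.
    congr (vol R k _); apply/seteqP; split => y; rewrite xsectionE /= corner_glue /=.
      by case.
    by [].
  rewrite [LHS]/= (_ : xsection _ _ = set0) ?measure0 //.
  apply/seteqP; split => // y; rewrite xsectionE /= corner_glue /= => -[x0 [y0 y1]].
  move/negP: xD; apply; rewrite inE /D /= itv_boundlr /=; apply/andP; split.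
    by case: (s ord0) x0.
  rewrite /Order.le /=.
  rewrite -subr_gt0; apply: le_lt_trans y1; apply: sumr_ge0 => i _.
  exact: lteifW (y0 i).
have mf (A : set R) : measurable_fun A (fun x : R => ((k`!%:R^-1)%:E * ((1 - x) ^+ k)%:E)%E).
  apply: measurable_funeM; apply/measurable_EFinP; apply: measurable_funX.
  exact: measurable_funB.
rewrite integral_itv_bndoo; last exact: mf.
rewrite -(integral_itv_bndoo true false); last exact: mf.
rewrite ge0_integralZl //; last first.
- by move=> x; rewrite /= in_itv /= => /andP[_ x1]; rewrite lee_fin exprn_ge0 // subr_ge0.
- apply/measurable_EFinP; apply: measurable_funX; exact: measurable_funB.
rewrite (@continuous_FTC2 _ _ (fun x => (1 - x) ^+ k.+1 / - k.+1%:R)) //=.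
- rewrite subrr expr0n /= mul0r subr0 expr1n mul1r -EFinB -EFinM sub0r.
  by rewrite factS natrM invfM mulrC invrN opprK.
- by apply: continuous_in_subspaceT => x x01; exact: continuous_onemXn.
- exact: derivable_oo_LRcontinuous_onemXnMr.
- move=> x x01; rewrite derive1Mr; last exact: onemXn_derivable.
  by rewrite derive_onemXn mulrAC divff// mul1r.
Qed.

Lemma vol_corner k (s : 'I_k -> bool) t : 0 < t ->
  vol R k (corner s false t) = (t ^+ k / k`!%:R)%:E.
Proof. by move=> t0; rewrite vol_corner_scale // vol_corner1. Qed.

Lemma vol_corner_lty k (s : 'I_k -> bool) b t : (vol R k (corner s b t) < +oo)%E.
Proof.
pose u := Num.max t 0 + 1.
have tu : t < u by rewrite ltr_pwDr // le_max lexx.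
have u0 : 0 < u by rewrite ltr_pwDr // le_max lexx orbT.
apply: (@le_lt_trans _ _ (vol R k (corner s false u))); last by rewrite vol_corner // ltry.
apply: le_measure; rewrite ?inE; try exact: measurable_corner.
move=> c [c0 ct]; split=> //; apply: le_lt_trans tu; exact: lteifW ct.
Qed.
End Simplex.

(** * Convex hulls of finitely many points *)

Section ConvexHull.
Variable R : realType.

Definition convex_coeffs n (c : 'cV[R]_n) := (forall i, 0 <= c i 0) /\ \sum_i c i 0 = 1.

Lemma convex_setE m (S : set 'cV[R]_m) :
  @convex_set R 'cV[R]_m S <->
  (forall x y t, S x -> S y -> 0 <= t -> t <= 1 -> S (t *: x + (1 - t) *: y)).
Proof.
split=> [cS x y t Sx Sy t0 t1|cS x y t].
  have := cS x y (Itv01 t0 t1); rewrite !inE; exact.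
by rewrite !inE => Sx Sy; apply: cS.
Qed.

(** Peeling off the first coefficient and rescaling the others reduces a convex
    combination to binary ones. *)
Lemma convex_comb m n (P : 'M[R]_(m, n)) (S : set 'cV[R]_m) (c : 'cV[R]_n) :
  @convex_set R 'cV[R]_m S -> (forall i, S (col i P)) -> convex_coeffs c -> S (P *m c).
Proof.
move=> /convex_setE cS; elim: n P c => [|n IH] P c SP [c0 c1].
  by move: c1; rewrite big_ord0 => /eqP; rewrite eq_sym oner_eq0.
pose P' : 'M[R]_(m, 1 + n) := P; pose c' : 'cV[R]_(1 + n) := c.
have E : P *m c = c 0 0 *: col 0 P + rsubmx P' *m dsubmx c'.
  have -> : P *m c = row_mx (lsubmx P') (rsubmx P') *m col_mx (usubmx c') (dsubmx c').
    by rewrite hsubmxK vsubmxK.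
  rewrite mul_row_col; congr (_ + _).
  apply/matrixP => i j; rewrite !mxE big_ord1 !mxE ord1 [RHS]mulrC.
  by congr (P _ _ * c _ _); rewrite ?ord1 //; exact/val_inj.
have S' i : S (col i (rsubmx P')).
  rewrite (_ : col i _ = col (lift ord0 i) P) //.
  by apply/matrixP => r j; rewrite !mxE; congr (fun_of_matrix _ _ _); exact/val_inj.
have c'0 i : 0 <= dsubmx c' i 0 by rewrite mxE; exact: c0.
have sE : \sum_i dsubmx c' i 0 = 1 - c 0 0.
  apply/eqP; rewrite eq_sym subr_eq -c1 big_ord_recl addrC; apply/eqP; congr (_ + _).
  by apply: eq_bigr => i _; rewrite mxE; congr (fun_of_matrix _ _ _); exact/val_inj.
have c01 : c 0 0 <= 1 by rewrite -subr_ge0 -sE; apply: sumr_ge0 => i _.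
have [c11|c11] := eqVneq (c 0 0) 1.
  rewrite E c11 scale1r (_ : dsubmx c' = 0) ?mulmx0 ?addr0 //.
  apply/matrixP => i j; rewrite ord1 [RHS]mxE.
  move: sE; rewrite c11 subrr => /eqP; rewrite psumr_eq0 //.
  by move=> /allP /(_ i (mem_index_enum _)) /eqP.
have t0 : 0 < 1 - c 0 0 by rewrite subr_gt0 lt_neqAle c11.
rewrite E (_ : _ *m _ = (1 - c 0 0) *: (rsubmx P' *m ((1 - c 0 0)^-1 *: dsubmx c'))).
  apply: cS => //; apply: IH => //; split.
    by move=> i; rewrite mxE mulr_ge0 // invr_ge0 ltW.
  under eq_bigr do rewrite mxE.
  by rewrite -mulr_sumr sE mulVf // gt_eqF.
by rewrite -scalemxAr scalerA mulfV ?gt_eqF // scale1r.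
Qed.

Lemma conv_cols m n (P : 'M[R]_(m, n)) :
  conv [set x | exists i, x = col i P] =
  [set x | exists2 c, convex_coeffs c & x = P *m c].
Proof.
apply/seteqP; split.
  apply: smallest_sub.
    apply/convex_setE => _ _ t [c [c0 c1] ->] [d [d0 d1] ->] t0 t1.
    exists (t *: c + (1 - t) *: d); last by rewrite mulmxDr -!scalemxAr.
    split=> [i|]; first by rewrite !mxE addr_ge0 // mulr_ge0 // subr_ge0.
    under eq_bigr do rewrite !mxE.
    by rewrite big_split /= -!mulr_sumr c1 d1; ring.
  move=> _ [i ->]; exists (delta_mx i 0); last by rewrite colE.
  split=> [j|]; first by rewrite mxE eqxx andbT; case: (j == i).
  rewrite (bigD1 i) //= big1 ?addr0 ?mxE ?eqxx // => j ji.
  by rewrite mxE (negbTE ji).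
move=> _ [c cc ->] S [cS PS]; apply: convex_comb => // i.
by apply: PS; exists i.
Qed.

(** Adjoining 0 to the points relaxes the sum condition, 0 taking up the missing weight.
    *)
Lemma conv_cols0 m n (P : 'M[R]_(m, n)) :
  conv ([set x | exists i, x = col i P] `|` [set 0]) =
  [set x | exists c : 'cV[R]_n, [/\ forall i, 0 <= c i 0, \sum_i c i 0 <= 1 & x = P *m c]].
Proof.
pose P' : 'M[R]_(m, 1 + n) := row_mx 0 P.
rewrite (_ : _ `|` _ = [set x | exists i, x = col i P']).
  rewrite conv_cols; apply/seteqP; split=> x.
    case=> c [c0 c1] ->; exists (dsubmx c); split.
    - by move=> i; rewrite mxE.
    - rewrite -c1 (@big_split_ord _ _ _ 1 n) /= big_ord1.
      by rewrite (eq_bigr (fun i => c (rshift 1 i) 0)) ?lerDr // => i _; rewrite mxE.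
    - by rewrite -{1}(vsubmxK c) mul_row_col mul0mx add0r.
  case=> c [c0 c1 ->]; exists (col_mx (const_mx (1 - \sum_i c i 0)) c).
    split=> [i|].
      by rewrite -(fintype.splitK i); case: (fintype.split i) => j /=;
        rewrite ?col_mxEu ?col_mxEd // mxE subr_ge0.
    rewrite (@big_split_ord _ _ _ 1 n) /= big_ord1 col_mxEu mxE.
    rewrite (eq_bigr _ (fun i _ => col_mxEd _ _ i 0)).
    by rewrite subrK.
  by rewrite mul_row_col mul0mx add0r.
apply/seteqP; split=> x.
  case=> [[i ->]|->]; first by exists (rshift 1 i); rewrite colKr.
  by exists (lshift n 0); rewrite colKl; apply/matrixP => i j; rewrite !mxE.
case=> i ->; rewrite -(fintype.splitK i); case: (fintype.split i) => j /=.
  by right; rewrite colKl; apply/matrixP => r q; rewrite !mxE.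
by left; exists j; rewrite colKr.
Qed.
End ConvexHull.

(** * Volume of a circuit *)

Lemma measure_disjoint_bigU d (T : measurableType d) (R : realType)
    (mu : {measure set T -> \bar R}) (I : choiceType) (r : seq I) (P : pred I)
    (F : I -> set T) :
  uniq r -> (forall i, P i -> measurable (F i)) ->
  (forall i j x, P i -> P j -> F i x -> F j x -> i = j) ->
  mu (\big[setU/set0]_(i <- r | P i) F i) = (\sum_(i <- r | P i) mu (F i))%E.
Proof.
move=> + mF dF; elim: r => [|a r IH] /=; first by rewrite !big_nil measure0.
case/andP=> ar ur; rewrite !big_cons; case: ifP => Pa; last exact: IH.
rewrite measureU; [congr (_ + _)%E; exact: IH|exact: mF|exact: bigsetU_measurable|].
apply/seteqP; split=> x //= -[Fa]; rewrite -bigcup_seq_cond => -[i /= /andP[ir Pi] Fi].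
by move: ar; rewrite (dF a i x) // ir.
Qed.

Lemma measure_bigU_lty d (T : measurableType d) (R : realType)
    (mu : {measure set T -> \bar R}) (I : choiceType) (r : seq I) (P : pred I)
    (F : I -> set T) :
  (forall i, P i -> measurable (F i)) -> (forall i, P i -> (mu (F i) < +oo)%E) ->
  (mu (\big[setU/set0]_(i <- r | P i) F i) < +oo)%E.
Proof.
move=> mF Foo; elim: r => [|a r IH] /=; first by rewrite big_nil measure0.
rewrite !big_cons; case: ifP => Pa //.
apply: le_lt_trans (measureU2 _ (mF _ Pa) (bigsetU_measurable _ _)) _ => //.
by apply: lte_add_pinfty => //; exact: Foo.
Qed.

Section Circuit.
Variables (R : realType) (k : nat) (E : 'M[R]_(k, k.+1)) (lam : 'cV[R]_k.+1).
Hypotheses (lam_neq0 : forall i, lam i 0 != 0) (Elam : E *m lam = 0)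
  (detE : forall i, `|\det (col' i E)| = `|lam i 0|).

Lemma col'_unit i : col' i E \in unitmx.
Proof. by rewrite unitmxE unitfE -normr_eq0 detE normr_eq0. Qed.

Lemma mul_col' i (c : 'cV[R]_k.+1) : c i 0 = 0 -> E *m c = col' i E *m row' i c.
Proof.
move=> ci; apply/matrixP => r j; rewrite !mxE (bigD1_ord i) //= ord1 ci mulr0 add0r.
by apply: eq_bigr => q _; rewrite !mxE.
Qed.

Lemma circuit_ker (c : 'cV[R]_k.+1) : E *m c = 0 -> exists s, c = s *: lam.
Proof.
move=> Ec; exists (c ord0 0 / lam ord0 0); apply/eqP; rewrite -subr_eq0; apply/eqP.
set d := c - _; have d0 : d ord0 0 = 0 by rewrite !mxE divfK ?subrr.
have : E *m d = 0 by rewrite mulmxBr Ec -scalemxAr Elam scaler0 subr0.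
rewrite (mul_col' d0) => /(congr1 (mulmx (invmx (col' ord0 E)))).
rewrite mulmx0 mulKmx ?col'_unit // => /matrixP d'.
apply/matrixP => i j; rewrite ord1 [RHS]mxE.
by case: (fintype.unliftP ord0 i) => [q ->|-> //]; have := d' q 0; rewrite !mxE.
Qed.

Lemma circuit_repr (c d : 'cV[R]_k.+1) : E *m c = E *m d ->
  exists s, forall i, d i 0 = c i 0 + s * lam i 0.
Proof.
move=> cd; have [|s ds] := @circuit_ker (d - c); first by rewrite mulmxBr cd subrr.
by exists s => i; have /matrixP/(_ i 0) := ds; rewrite !mxE => <-; rewrite addrCA subrr addr0.
Qed.

(** The image under E of a subset D of the coordinate hyperplane c_i = 0: a simplex
    spanned by 0 and the columns of E other than the i-th when D is a coordinate
    simplex. *)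
Definition facet_image i (D : set (vec R k)) : set (vec R k) :=
  [set x : 'cV[R]_k | exists c : 'cV[R]_k.+1, [/\ c i 0 = 0, D (row' i c) & x = E *m c]].

Lemma facet_imageE i D :
  facet_image i D = (mulmx (invmx (col' i E)) : vec R k -> vec R k) @^-1` D.
Proof.
apply/seteqP; split=> x; rewrite /facet_image /=.
  by case=> c [ci Dc ->]; rewrite (mul_col' ci) mulKmx // col'_unit.
move=> Dx; pose y := invmx (col' i E) *m x.
pose c : 'cV[R]_k.+1 := \col_j (if fintype.unlift i j is Some q then y q 0 else 0).
have ci : c i 0 = 0 by rewrite mxE fintype.unlift_none.
have cy : row' i c = y.
  by apply/matrixP => q j; rewrite ord1 [LHS]mxE [LHS]mxE fintype.liftK.
exists c; split; [exact: ci|by rewrite cy|by rewrite (mul_col' ci) cy mulKVmx ?col'_unit].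
Qed.

Lemma measurable_facet_image i D : measurable D -> measurable (facet_image i D).
Proof.
move=> mD; rewrite facet_imageE -[X in measurable X]setTI.
have := @measurable_affine R k k (invmx (col' i E)) 0.
rewrite (_ : (fun _ => _) = mulmx (invmx (col' i E))); first exact.
by apply/funext => x; rewrite addr0.
Qed.

Lemma vol_facet_image i D : measurable D ->
  vol R k (facet_image i D) = (`|lam i 0|%:E * vol R k D)%E.
Proof.
move=> mD; rewrite facet_imageE scales_unitmx ?unitmx_inv ?col'_unit //.
by rewrite det_inv normfV invrK detE.
Qed.

Lemma sum_row' i (c : 'cV[R]_k.+1) : c i 0 = 0 -> \sum_j row' i c j 0 = \sum_j c j 0.
Proof.
move=> ci; rewrite [RHS](bigD1_ord i) //= ci add0r.
by apply: eq_bigr => j _; rewrite mxE.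
Qed.

Local Notation K := (conv ([set x | exists i, x = col i E] `|` [set 0])).
Local Notation C := (conv [set x | exists i, x = col i E]).

(** Strictness at the negative indices before i: it puts a point lying on several closed
    cells into the first one only. *)
Definition tie (i : 'I_k.+1) : 'I_k -> bool :=
  fun j => ~~ ((lam (lift i j) 0 < 0) && (lift i j < i)%N).

Definition halfopen_cell i := facet_image i (corner (tie i) false 1).

Lemma halfopen_cellP i x : halfopen_cell i x <-> exists c : 'cV[R]_k.+1,
  [/\ c i 0 = 0, forall j, 0 <= c j 0,
     forall j : 'I_k.+1, (j < i)%N -> lam j 0 < 0 -> 0 < c j 0,
     \sum_j c j 0 < 1 & x = E *m c].
Proof.
split=> [[c [ci [c0 c1] ->]]|[c [ci c0 cj c1 ->]]]; exists c; split => //.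
- move=> j; case: (fintype.unliftP i j) => [q ->|->]; last by rewrite ci.
  by have := c0 q; rewrite mxE; exact: lteifW.
- move=> j ji lj; case: (fintype.unliftP i j) => [q jE|jE]; last by rewrite jE ltnn in ji.
  by have := c0 q; rewrite mxE /tie -jE lj ji.
- by rewrite -(sum_row' ci).
- split; last by rewrite sum_row'.
  move=> q; rewrite mxE /tie.
  by case: (boolP (_ && _)) => [/andP[lj ji]|_] /=; [exact: cj|exact: c0].
Qed.

Hypothesis lam_sum : 0 <= \sum_i lam i 0.
Hypothesis lam_neg : exists i, lam i 0 < 0.
Hypothesis lam_pos : exists i, 0 < lam i 0.

(** Two representations of a point differ by a multiple of lam. Passing from the cell of
    i to that of j > i raises the i-th coefficient from 0, so it raises every
    coefficient with a negative entry of lam, and the j-th cannot become 0. *)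
Lemma halfopen_cell_inj i j x : lam i 0 < 0 -> lam j 0 < 0 ->
  halfopen_cell i x -> halfopen_cell j x -> i = j.
Proof.
wlog ij : i j / (i < j)%N.
  move=> H li lj pi pj; have [ij|ji|/val_inj //] := ltngtP i j; first exact: H.
  by apply/esym; exact: H.
move=> li lj /halfopen_cellP[c [ci c0 _ _ ->]].
move=> /halfopen_cellP[d [dj d0 dpos _ /circuit_repr[s ds]]].
have := dpos i ij li; rewrite ds ci add0r nmulr_lgt0 // => s0.
have := ds j; rewrite dj => /eqP; rewrite eq_sym paddr_eq0 //; last first.
  by rewrite ltW // nmulr_rgt0.
by rewrite mulf_eq0 (lt_eqF s0) (negbTE (lam_neq0 j)) andbF.
Qed.

Definition closed_cell i := facet_image i (corner (fun=> true) true 1).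

(** Subtracting the largest multiple of lam that keeps all coefficients nonnegative
    makes one with lam_i > 0 vanish, and does not increase their sum. The cells overlap;
    this covering serves for measurability and finiteness only. *)
Lemma conv0_closed_cell :
  K = \big[setU/set0]_(i <- index_enum 'I_k.+1 | 0 < lam i 0) closed_cell i.
Proof.
rewrite -bigcup_seq_cond conv_cols0; apply/seteqP; split=> x /=.
  case=> c [c0 c1 ->]; have [i0 i0P] := lam_pos.
  case: (@Order.TotalTheory.arg_minP _ _ _ i0 (fun i => 0 < lam i 0)
    (fun i => c i 0 / lam i 0) i0P) => i li imin.
  exists i; first by rewrite /= mem_index_enum.
  pose t := c i 0 / lam i 0; have t0 : 0 <= t by rewrite divr_ge0 // ltW.
  pose d := c - t *: lam; have dE j : d j 0 = c j 0 - t * lam j 0 by rewrite !mxE.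
  exists d; split.
  - by rewrite dE divfK ?subrr.
  - split=> [j|].
      rewrite mxE /= dE subr_ge0; case: (ltrP 0 (lam (lift i j) 0)) => lj.
        by rewrite -ler_pdivlMr //; exact: imin.
      by apply: le_trans (c0 _); rewrite mulr_ge0_le0.
    rewrite sum_row'; last by rewrite dE divfK ?subrr.
    apply: le_trans c1; rewrite (eq_bigr _ (fun j _ => dE j)).
    by rewrite sumrB lerBlDr lerDl -mulr_sumr mulr_ge0.
  - by rewrite mulmxBr -scalemxAr Elam scaler0 subr0.
case=> i /andP[_ li] [c [ci [c0 c1] ->]]; exists c; split => //.
- move=> j; case: (fintype.unliftP i j) => [q ->|->]; last by rewrite ci.
  by have := c0 q; rewrite mxE.
- by rewrite -(sum_row' ci).
Qed.

(** Adding multiples of lam moves a coefficient with lam_i < 0 to 0 before the sum of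
    the coefficients reaches 1, otherwise the point would lie in C. Conversely on such a
    cell every other nonnegative representation has a smaller or equal sum, so the point
    is not in C. *)
Lemma conv0_minus :
  K `\` C = \big[setU/set0]_(i <- index_enum 'I_k.+1 | lam i 0 < 0) halfopen_cell i.
Proof.
rewrite -bigcup_seq_cond conv_cols0 conv_cols; apply/seteqP; split=> x /=.
  case=> -[c [c0 c1 ->]] nC; have [i0 i0P] := lam_neg.
  have c1' : \sum_i c i 0 < 1.
    by rewrite lt_neqAle c1 andbT; apply/eqP => cE; apply: nC; exists c.
  (* r i is the multiple of lam at which the i-th coefficient vanishes; i is the first
     index where r is minimal among those with lam_i < 0. *)
  pose r i := c i 0 / - lam i 0.
  case: (@Order.TotalTheory.arg_minP _ _ _ i0 (fun i => lam i 0 < 0) r i0P) =>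
    i1 li1 i1min.
  have i1P : (lam i1 0 < 0) && (r i1 == r i1) by rewrite li1 eqxx.
  case: (@arg_minnP _ i1 (fun i => (lam i 0 < 0) && (r i == r i1)) (@nat_of_ord _) i1P) =>
    i /andP[li /eqP ri] imin.
  exists i; first by rewrite /= mem_index_enum.
  have t0 : 0 <= r i by rewrite divr_ge0 // oppr_ge0 ltW.
  pose d t := c + t *: lam; have dE t j : d t j 0 = c j 0 + t * lam j 0 by rewrite !mxE.
  have dsum t : \sum_j d t j 0 = \sum_j c j 0 + t * \sum_j lam j 0.
    by rewrite (eq_bigr _ (fun j _ => dE t j)) big_split /= mulr_sumr.
  have Ed t : E *m d t = E *m c by rewrite mulmxDr -scalemxAr Elam scaler0 addr0.
  have dge0 t j : 0 <= t -> t <= r i -> 0 <= d t j 0.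
    move=> t0' tr; rewrite dE; case: (ltrP (lam j 0) 0) => lj.
      rewrite -[t * _]opprK -mulrN subr_ge0 -ler_pdivlMr ?oppr_gt0 //.
      by apply: le_trans tr _; rewrite ri; exact: i1min.
    by rewrite addr_ge0 // mulr_ge0.
  apply/halfopen_cellP; exists (d (r i)); split.
  - by rewrite dE /r invrN mulrN mulNr divfK ?subrr.
  - by move=> j; exact: dge0.
  - move=> j ji lj; rewrite dE -[_ * lam j 0]opprK -mulrN subr_gt0 -ltr_pdivlMr ?oppr_gt0 //.
    rewrite lt_neqAle {2}ri i1min // andbT; apply/eqP => rij.
    by have := imin j; rewrite lj -ri rij eqxx => /(_ isT); rewrite leqNgt ji.
  - rewrite ltNge; apply/negP => d1; apply: nC.
    have S0 : 0 < \sum_j lam j 0.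
      rewrite lt_neqAle lam_sum andbT; apply/eqP => S0; move: d1.
      by rewrite dsum -S0 mulr0 addr0 leNgt c1'.
    (* The multiple of lam at which the coefficients sum to 1. *)
    pose t := (1 - \sum_j c j 0) / \sum_j lam j 0.
    exists (d t); last by rewrite Ed.
    split; last by rewrite dsum divfK ?gt_eqF // addrC subrK.
    move=> j; apply: dge0; first by rewrite divr_ge0 // ?subr_ge0 ltW.
    by rewrite ler_pdivrMr // lerBlDl -dsum.
  - by rewrite Ed.
case=> i /andP[_ li] /halfopen_cellP[c [ci c0 _ c1 ->]]; split.
  by exists c; split => //; exact: ltW.
case=> d [d0 d1] /circuit_repr[s ds].
have s0 : s <= 0 by have := d0 i; rewrite ds ci add0r nmulr_lge0.
move: d1; rewrite (eq_bigr _ (fun j _ => ds j)) big_split /= -mulr_sumr => d1.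
have : \sum_i c i 0 + s * \sum_i lam i 0 < 1.
  by rewrite -[X in _ < X]addr0 ltr_leD // mulr_le0_ge0.
by rewrite d1 ltxx.
Qed.

Lemma measurable_halfopen_cell i : measurable (halfopen_cell i).
Proof. by apply: measurable_facet_image; exact: measurable_corner. Qed.
Lemma measurable_closed_cell i : measurable (closed_cell i).
Proof. by apply: measurable_facet_image; exact: measurable_corner. Qed.

Lemma conv_sub_conv0 : C `<=` K.
Proof.
rewrite conv_cols conv_cols0 => x [c [c0 c1] ->].
by exists c; split=> //; rewrite c1.
Qed.

(** C is measurable as the complement in K of the cells, so its volume is never
    computed: the difference is the total volume of the cells. *)
Lemma circuit_volume_sum_ge0 :
  nvol K - nvol C = \sum_(i | lam i 0 < 0) `|lam i 0|.
Proof.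
have mK : measurable (K : set (vec R k)).
  by rewrite conv0_closed_cell; apply: bigsetU_measurable => i _; exact: measurable_closed_cell.
have mKC : measurable (K `\` C : set (vec R k)).
  by rewrite conv0_minus; apply: bigsetU_measurable => i _; exact: measurable_halfopen_cell.
have mC : measurable (C : set (vec R k)).
  rewrite (_ : C = K `\` (K `\` C)); first exact: measurableD.
  by rewrite setDD setIidr //; exact: conv_sub_conv0.
have Woo i : (vol R k (closed_cell i) < +oo)%E.
  have -> := vol_facet_image i (measurable_corner (fun=> true) true 1).
  by rewrite lte_mul_pinfty // vol_corner_lty.
have Koo : (vol R k K < +oo)%E.
  rewrite conv0_closed_cell; apply: measure_bigU_lty => i _.
    exact: measurable_closed_cell.
  exact: Woo.
have KE : vol R k K = (vol R k C + (\sum_(i | lam i 0 < 0) `|lam i 0| / k`!%:R)%:E)%E.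
  rewrite (measureDI (vol R k) mK mC) (setIidr conv_sub_conv0) addeC; congr (_ + _)%E.
  rewrite conv0_minus.
  transitivity (\sum_(i | lam i 0 < 0) vol R k (halfopen_cell i)).
    apply: measure_disjoint_bigU => [|i _|i j x]; first exact: index_enum_uniq.
      exact: measurable_halfopen_cell.
    exact: halfopen_cell_inj.
  rewrite -sumEFin; apply: eq_bigr => i _.
  have -> := vol_facet_image i (measurable_corner (tie i) false 1).
  by rewrite vol_corner // expr1n mul1r.
have Coo : vol R k C \is a fin_num.
  rewrite ge0_fin_numE //; apply: le_lt_trans Koo.
  by apply: le_measure; rewrite ?inE //; exact: conv_sub_conv0.
rewrite /nvol !leb_volE // KE fineD // /= mulrDr addrAC subrr add0r mulr_sumr.
by apply: eq_bigr => i _; rewrite mulrC divfK.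
Qed.
End Circuit.

(** Changing the sign of lam exchanges the two sums, so one may assume that the sum of
    its entries is nonnegative. *)
Lemma circuit_volume (R : realType) k (E : 'M[R]_(k, k.+1)) (lam : 'cV[R]_k.+1) :
  (forall i, lam i 0 != 0) -> E *m lam = 0 ->
  (forall i, `|\det (col' i E)| = `|lam i 0|) ->
  (exists i, lam i 0 < 0) -> (exists i, 0 < lam i 0) ->
  nvol (conv ([set x | exists i, x = col i E] `|` [set 0])) -
  nvol (conv [set x | exists i, x = col i E]) =
  Num.min (\sum_(i | 0 < lam i 0) `|lam i 0|) (\sum_(i | lam i 0 < 0) `|lam i 0|).
Proof.
move=> lam0 Elam detE lamN lamP.
have sumE : \sum_i lam i 0 =
    \sum_(i | 0 < lam i 0) `|lam i 0| - \sum_(i | lam i 0 < 0) `|lam i 0|.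
  rewrite (bigID (fun i => 0 < lam i 0)) /= -sumrN; congr (_ + _).
    by apply: eq_bigr => i /gtr0_norm.
  apply: eq_big => i; first by rewrite -leNgt le_eqVlt (negbTE (lam0 i)).
  by rewrite -leNgt => /ler0_norm ->; rewrite opprK.
have [s0|/ltW s0] := leP 0 (\sum_i lam i 0).
  rewrite (circuit_volume_sum_ge0 lam0 Elam detE s0 lamN lamP) min_r //.
  by move: s0; rewrite sumE subr_ge0.
have lam0' i : (- lam) i 0 != 0 by rewrite mxE oppr_eq0.
have Elam' : E *m (- lam) = 0 by rewrite mulmxN Elam oppr0.
have detE' i : `|\det (col' i E)| = `|(- lam) i 0| by rewrite mxE normrN.
have s0' : 0 <= \sum_i (- lam) i 0.
  rewrite (eq_bigr (fun i => - lam i 0)); last by move=> i _; rewrite mxE.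
  by rewrite sumrN oppr_ge0.
have lamN' : exists i, (- lam) i 0 < 0.
  by have [i li] := lamP; exists i; rewrite mxE oppr_lt0.
have lamP' : exists i, 0 < (- lam) i 0.
  by have [i li] := lamN; exists i; rewrite mxE oppr_gt0.
rewrite (circuit_volume_sum_ge0 lam0' Elam' detE' s0' lamN' lamP') min_l; last first.
  by move: s0; rewrite sumE subr_le0.
by apply: eq_big => i; rewrite mxE ?oppr_lt0 // normrN.
Qed.

(** * Integer matrices *)

Section IntegerMatrices.

Lemma unit_intP (x : int) : x \is a GRing.unit -> x = 1 \/ x = -1.
Proof. by case/orP => /eqP; [left|right]. Qed.

Lemma primitive_pairing (v : 'rV[int]_2) : primitive_vec v ->
  exists w : 'cV[int]_2, v *m w = 1%:M.
Proof.
move=> pv; pose g := gcdz (v 0 0) (v 0 1).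
have [x [y xy]] := Bezoutz (v 0 0) (v 0 1).
have /pv g1 : v = g *: (\row_j (v 0%R j %/ g)%Z).
  apply/rowP => j; rewrite !mxE mulrC divzK //.
  have -> : j = 0 \/ j = 1 -> (g %| v 0%R j)%Z by case=> ->; rewrite ?dvdz_gcdl ?dvdz_gcdr.
    by [].
  by case: j => -[|[|//]] ?; [left|right]; apply/val_inj.
have vE (w : 'cV[int]_2) : v *m w = (v 0 0 * w 0 0 + v 0 1 * w 1 0)%:M.
  apply/matrixP => i j; rewrite !ord1 !mxE big_ord_recl big_ord1 eqxx mulr1n.
  by congr (_ + v _ _ * w _ _); apply/val_inj.
exists (g *: \col_i (if i == 0 then x else y)).
rewrite -scalemxAr vE !mxE /= [v 0 0 * _]mulrC [v 0 1 * _]mulrC xy -/g scale_scalar_mx.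
by case: g1 => ->.
Qed.

(** The Smith normal form of a single column; g is its gcd. *)
Lemma unimodular_column k (c : 'cV[int]_k.+1) : c != 0 ->
  exists (V W : 'M[int]_(1 + k)) (g : int),
    [/\ V *m W = 1%:M, W *m V = 1%:M, 0 < g & V *m c = g *: delta_mx 0 0].
Proof.
move=> c0; have [L uL [r ur [d _ cE]]] := int_Smith_normal_form c.
have [s s2 rE] : exists2 s : int, s * s = 1 & r = s%:M.
  exists (r 0 0); last by rewrite -mx11_scalar.
  have : \det r \is a GRing.unit by rewrite -unitmxE.
  rewrite {1}[r]mx11_scalar det_scalar1.
  by case/unit_intP => ->.
have E : invmx L *m c = (s * d`_0) *: delta_mx 0 0.
  rewrite cE -!mulmxA mulKmx // rE mul_mx_scalar -scalerA; congr (_ *: _).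
  apply/matrixP => i j; rewrite !ord1 !mxE eqxx andbT.
  rewrite -[i == 0]val_eqE /=.
  by have [->|i0] := eqVneq (nat_of_ord i) 0%N; rewrite ?mulr1 ?mulr0.
set h := s * _ in E.
have h0 : h != 0.
  apply: contraNneq c0 => h0; rewrite -[c](mulKVmx uL) E h0 scale0r mulmx0 //.
have [hp|hn] := ltP 0 h.
  by exists (invmx L), L, h; rewrite mulVmx // mulmxV.
exists (- invmx L), (- L), (- h).
rewrite !mulNmx !mulmxN !opprK mulVmx // mulmxV // E scaleNr.
by split=> //; rewrite oppr_gt0 lt_neqAle h0.
Qed.

(** In the coordinates given by V, the vectors killed by the lower rows are the
    multiples of the first unit vector. *)
Lemma unimodular_ker (F : comUnitRingType) k (V W : 'M[F]_(1 + k)) (z : 'cV[F]_(1 + k)) :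
  W *m V = 1%:M -> dsubmx V *m z = 0 -> z = (usubmx V *m z) 0 0 *: col 0 W.
Proof.
move=> WV Qz; rewrite -{1}[z]mul1mx -WV -mulmxA -{1}(vsubmxK V) mul_col_mx Qz.
rewrite [X in col_mx X]mx11_scalar; set a := (_ *m _) 0 0.
apply/matrixP => i j; rewrite ord1 !mxE (@big_split_ord _ _ _ 1 k) /= big_ord1.
rewrite col_mxEu mxE eqxx mulr1n.
rewrite big1 ?addr0; last by move=> q _; rewrite col_mxEd mxE mulr0.
by rewrite mulrC; congr (a * W _ _); apply/val_inj.
Qed.

(** Apply the adjugate of the square matrix with rows rho and E to the vector l, which
    that matrix sends to the first unit vector. *)
Lemma cofactor_kernel (F : comUnitRingType) k (E : 'M[F]_(k, 1 + k)) (rho : 'rV[F]_(1 + k))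
    (l : 'cV[F]_(1 + k)) : E *m l = 0 -> rho *m l = 1%:M ->
  forall i : 'I_(1 + k), \det (col_mx rho E) * l i 0 = (-1) ^+ i * \det (col' i E).
Proof.
move=> El rl i; set N : 'M[F]_(1 + k) := col_mx rho E.
have Nl : N *m l = delta_mx 0 0.
  rewrite mul_col_mx El rl; apply/matrixP => p q; rewrite ord1 -(fintype.splitK p).
  case: (fintype.split p) => j /=; first by rewrite ord1 col_mxEu !mxE.
  by rewrite col_mxEd !mxE.
have : \adj N *m N *m l = \adj N *m delta_mx 0 0 by rewrite -mulmxA Nl.
rewrite mul_adj_mx mul_scalar_mx -colE => /matrixP/(_ i 0).
rewrite !mxE => ->; rewrite /cofactor add0n; congr (_ * \det _).
apply/matrixP => p q; rewrite !mxE.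
have -> : lift 0 p = rshift 1 p :> 'I_(1 + k) by apply/val_inj.
by have -> := fintype.unsplitK (inr p : 'I_1 + 'I_k)%type.
Qed.

Lemma surjective_det_unit m (N : 'M[int]_m) :
  (forall y : 'cV[int]_m, exists x, N *m x = y) ->
  `|\det N| = 1.
Proof.
move=> sN; have /fin_all_exists [x xE] j := sN (col j 1%:M).
pose M := \matrix_(i, j) x j i 0.
have NM : N *m M = 1%:M.
  apply/matrixP => i j; have /matrixP/(_ i 0) := xE j; rewrite !mxE => <-.
  by apply: eq_bigr => q _; rewrite mxE.
have := congr1 determinant NM; rewrite det_mulmx det1 => /eqP.
move=> /eqP d1; have : \det N \is a GRing.unit by apply/unitrPr; exists (\det M).
by case/unit_intP => ->.
Qed.

Lemma clear_denominators m (y : 'cV[rat]_m) :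
  exists (N : int) (z : 'cV[int]_m), N != 0 /\ N%:~R *: y = map_mx intr z.
Proof.
pose N := \prod_i denq (y i 0).
exists N, (\col_i (numq (y i 0) * \prod_(j | j != i) denq (y j 0))); split.
  by apply/prodf_neq0 => i _; exact: denq_neq0.
apply/colP => i; rewrite !mxE /N (bigD1 i) //= !intrM mulrAC; congr (_ * _).
by rewrite [in RHS]numqE mulrC.
Qed.
End IntegerMatrices.

(** * Faces of the polytope of a matrix *)

Section Faces.
Variables (R : realType) (d n : nat) (A : 'M[int]_(d, n)).
Local Notation Ar := (map_mx intr A : 'M[R]_(d, n)).
Local Notation P := (polytope R A).

Lemma real_vec_col i : real_vec R (col i A) = col i Ar.
Proof. exact: map_col. Qed.

Lemma polytopeE : P = [set x | exists2 t, convex_coeffs t & x = Ar *m t].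
Proof.
rewrite -conv_cols /polytope; congr conv; apply/seteqP.
by split=> x [i ->]; exists i; rewrite real_vec_col.
Qed.

Lemma polytope_col i : P (real_vec R (col i A)).
Proof. by move=> S [_ AS]; apply: AS; exists i. Qed.

Lemma in_cols_on (F : set 'cV[R]_d) i :
  (i \in cols_on A F) = `[< F (real_vec R (col i A)) >].
Proof. by rewrite inE. Qed.

Lemma cols_on_polytope : cols_on A P = [set: 'I_n]%SET.
Proof.
by apply/setP => i; rewrite in_cols_on finset.in_setT asboolT //; exact: polytope_col.
Qed.

(** The row w lists the slacks of the columns of A with respect to a supporting
    hyperplane of the face. *)
Lemma face_slack (F : set 'cV[R]_d) : is_face A F ->
  exists u c (w := const_mx c - u *m Ar : 'rV[R]_n),
   [/\ forall i, 0 <= w 0 i, forall i, (w 0 i == 0) = (i \in cols_on A F)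
     & forall x, F x <-> exists t, [/\ convex_coeffs t, w *m t = 0 & x = Ar *m t]].
Proof.
case=> _ [u [c [uP FE]]]; exists u, c; set w := _ - _.
have wE i : w 0 i = c - (u *m real_vec R (col i A)) 0 0.
  by rewrite real_vec_col !mxE; congr (_ - _); apply: eq_bigr => j _; rewrite !mxE.
split.
- by move=> i; rewrite wE subr_ge0; apply: uP; exact: polytope_col.
- move=> i; rewrite wE subr_eq0 in_cols_on FE; apply/eqP/asboolP => [->|[] //].
  by split=> //; exact: polytope_col.
have wt t : convex_coeffs t -> w *m t = (c - (u *m (Ar *m t)) 0 0)%:M.
  move=> [_ t1]; rewrite mulmxBl mulmxA; apply/matrixP => i j.
  rewrite !ord1 [LHS]mxE [RHS]mxE eqxx mulr1n [X in _ + X]mxE; congr (_ - _).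
  by rewrite mxE -[RHS]mulr1 -t1 mulr_sumr; apply: eq_bigr => q _; rewrite mxE.
move=> x; rewrite FE polytopeE /=; split.
  case=> -[t ct ->] ut; exists t; split=> //.
  by rewrite wt // ut subrr; apply/matrixP => i j; rewrite !mxE mul0rn.
case=> t [ct wt0 ->]; split; first by exists t.
move: wt0; rewrite wt // => /matrixP/(_ 0 0); rewrite !mxE eqxx mulr1n => /eqP.
by rewrite subr_eq0 => /eqP.
Qed.

(** A convex combination of the columns has slack 0 only if no column off the face
    contributes. *)
Lemma face_point (F : set 'cV[R]_d) x : is_face A F -> F x ->
  exists t, [/\ convex_coeffs t, forall i, i \in cols_off A F -> t i 0 = 0 & x = Ar *m t].
Proof.
move=> /face_slack[u [c [w0 won FE]]] /FE[t [[t0 t1] wt ->]]; exists t; split=> // i.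
rewrite inE -won => wi; set w := _ - _ in w0 wi wt.
move: wt => /matrixP/(_ 0 0); rewrite !mxE => /eqP.
rewrite psumr_eq0; last by move=> j _; rewrite mulr_ge0.
by move=> /allP/(_ i (mem_index_enum _)); rewrite mulf_eq0 (negbTE wi) => /eqP.
Qed.

Lemma face_cols_on (F : set 'cV[R]_d) : is_face A F -> exists i, i \in cols_on A F.
Proof.
move=> fF; have [[x Fx] _] := fF; have [t [[_ t1] toff _]] := face_point fF Fx.
apply/existsP; apply: contra_eqT t1 => /existsPn off.
rewrite big1 1?eq_sym ?oner_eq0 // => i _; apply: toff; by rewrite inE.
Qed.

Lemma face_cols_off (F : set 'cV[R]_d) : is_face A F -> F <> P ->
  exists i, i \in cols_off A F.
Proof.
move=> /face_slack[u [c [w0 won FE]]] FP.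
apply/existsP; apply: contra_notT FP => /existsPn off.
set w := _ - _ in w0 won FE.
have w00 : w = 0.
  apply/matrixP => p i; rewrite ord1 [RHS]mxE; apply/eqP; rewrite won.
  by have := off i; rewrite inE negbK.
apply/seteqP; split=> x; rewrite polytopeE.
  by move=> /FE[t [ct _ ->]]; exists t.
by case=> t ct ->; apply/FE; exists t; rewrite w00 mul0mx.
Qed.
End Faces.

(** * The lattice quotient by a face *)

Lemma mulmx_sum_col (T : comPzRingType) m n (M : 'M[T]_(m, n)) (z : 'cV[T]_n) :
  M *m z = \sum_i z i 0 *: col i M.
Proof.
apply/matrixP => i j; rewrite ord1 mxE summxE; apply: eq_bigr => q _.
by rewrite !mxE mulrC.
Qed.

Lemma additive_matrix p q (f : 'cV[int]_p -> 'cV[int]_q) :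
  (forall x y, f (x + y) = f x + f y) ->
  forall c, f c = (\matrix_(i, j) f (delta_mx j 0) i 0) *m c.
Proof.
move=> fD c; have f0 : f 0 = 0 by apply: (addrI (f 0)); rewrite -fD !addr0.
have fN x : f (- x) = - f x by apply: (addrI (f x)); rewrite -fD !subrr f0.
have fM (a : nat) x : f (x *+ a) = f x *+ a.
  by elim: a => [|a IH]; rewrite ?mulr0n // !mulrS fD IH.
have fZ (a : int) x : f (a *: x) = a *: f x.
  rewrite -[a]intz !scaler_int; case: a => a; first exact: fM.
  by rewrite !NegzE !mulrNz fN; congr (- _); exact: fM.
rewrite mulmx_sum_col {1}[c]matrix_sum_delta.
rewrite (eq_bigr (fun i => c i 0 *: delta_mx i 0)); last first.
  by move=> i _; rewrite big_ord1.
rewrite (big_morph f fD f0); apply: eq_bigr => i _; rewrite fZ; congr (_ *: _).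
by apply/matrixP => a b; rewrite ord1 !mxE.
Qed.

Lemma map_intr_ratr (R : realType) m1 m2 (M : 'M[int]_(m1, m2)) :
  map_mx intr M = map_mx ratr (map_mx intr M : 'M[rat]_(m1, m2)) :> 'M[R]_(m1, m2).
Proof. by apply/matrixP => i j; rewrite !mxE ratr_int. Qed.

Section Lattice.
Variables (R : realType) (d n : nat) (A : 'M[int]_(d, n)) (B : 'M[int]_(n, 2)).
Hypothesis galeB : is_gale_dual A B.
Variables (beta : set 'cV[R]_d) (beta_face : is_face A beta).
Variables (k : nat) (sigma : 'I_(1 + k) -> 'I_n).
Hypothesis sigma_inj : injective sigma.
Hypothesis sigma_off : forall i, (i \in cols_off A beta) = (i \in codom sigma).
Variables (V W : 'M[int]_(1 + k)) (g : int) (v : 'rV[int]_2) (w1 : 'cV[int]_2).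
Hypotheses (VW : V *m W = 1%:M) (WV : W *m V = 1%:M) (g_gt0 : 0 < g).
Hypothesis vw1 : v *m w1 = 1%:M.

(* S restricts a vector of Z^n to the coordinates off the face, which sigma enumerates.
   V is a unimodular matrix taking the column l to the first unit vector, so Q
   identifies Z^(1 + k) / Z l with Z^k, and rho is a linear form with value 1 on l. SB
   is the factorization b_i = lambda_i v with lambda = g l. *)
Let S : 'M[int]_(1 + k, n) := rowsub sigma 1%:M.
Let l : 'cV[int]_(1 + k) := col 0 W.
Let Q : 'M[int]_(k, 1 + k) := dsubmx V.
Let rho : 'rV[int]_(1 + k) := usubmx V.
Hypothesis SB : S *m B = g *: (l *m v).

Local Notation P := (polytope R A).
Local Notation toR M := (map_mx intr M).
Local Notation Ar := (map_mx intr A : 'M[R]_(d, n)).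

Lemma restrE (F : pzRingType) (z : 'cV[F]_n) j :
  (map_mx intr S *m z) j 0 = z (sigma j) 0.
Proof.
rewrite mxE (bigD1 (sigma j)) //= big1 => [|i ij]; first by rewrite !mxE eqxx mul1r addr0.
by rewrite !mxE eq_sym (negbTE ij) mul0r.
Qed.

Lemma map_mx_intz m1 m2 (M : 'M[int]_(m1, m2)) : map_mx (intr : int -> int) M = M.
Proof. by apply/matrixP => i j; rewrite mxE intz. Qed.

Lemma restr_eq0 (F : pzRingType) (z : 'cV[F]_n) :
  map_mx intr S *m z = 0 <-> (forall i, i \in cols_off A beta -> z i 0 = 0).
Proof.
split=> [/matrixP Sz i|z0].
  by rewrite sigma_off => /codomP[j ->]; rewrite -restrE Sz mxE.
by apply/matrixP => j q; rewrite ord1 restrE mxE z0 // sigma_off codom_f.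
Qed.

(** The transpose of S extends a vector by 0. *)
Lemma restr_ext : S *m S^T = 1%:M.
Proof.
rewrite mul_rowsub_mx mul1mx; apply/matrixP => i j.
by rewrite !mxE (inj_eq sigma_inj) eq_sym.
Qed.

Lemma gale_mul0 : A *m B = 0.
Proof.
have [AB _] := galeB; apply/matrixP => i j.
pose e : 'cV[int]_2 := delta_mx j 0.
have /matrixP/(_ i 0) : A *m (B *m e) = 0 by apply/AB; exists e.
by rewrite mulmxA -colE !mxE.
Qed.

Lemma unimodular_dual : rho *m l = 1%:M /\ Q *m l = 0.
Proof.
have : V *m l = delta_mx 0 0 by rewrite /l colE mulmxA VW mul1mx.
rewrite -{1}(vsubmxK V) mul_col_mx -/rho -/Q => E; split.
  apply/matrixP => i j; rewrite !ord1 -(col_mxEu _ (Q *m l)) E !mxE.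
  by congr (_%:R); congr (nat_of_bool _); apply/eqP/val_inj.
apply/matrixP => i j; rewrite ord1 -(col_mxEd (rho *m l)) E !mxE.
by [].
Qed.

Lemma QS_gale_mul0 : Q *m S *m B = 0.
Proof. by rewrite -mulmxA SB -scalemxAr mulmxA (proj2 unimodular_dual) mul0mx scaler0. Qed.

(** A rational vector in the kernel of A has an integer multiple there, which is in the
    image of B. *)
Lemma rat_ker (y : 'cV[rat]_n) :
  map_mx intr A *m y = 0 -> map_mx intr (Q *m S) *m y = 0.
Proof.
move=> Ay; have [N [z [N0 yz]]] := clear_denominators y.
have inj0 m (x : 'cV[int]_m) : map_mx (intr : int -> rat) x = 0 -> x = 0.
  move=> /matrixP x0; apply/matrixP => i j; have := x0 i j; rewrite !mxE => /eqP.
  by rewrite intr_eq0 => /eqP.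
have Az : A *m z = 0.
  by apply: inj0; rewrite map_mxM -yz -scalemxAr Ay scaler0.
have [w zw] : exists w, z = B *m w by apply/(proj1 galeB).
have NZ : N%:~R != 0 :> rat by rewrite intr_eq0.
apply/eqP; rewrite -(inj_eq (scalerI NZ)) scaler0 scalemxAr yz -map_mxM zw.
by rewrite mulmxA QS_gale_mul0 mul0mx map_mx0.
Qed.

(** The rows of Q S vanish on the kernel of A, hence are combinations of the rows of A:
    the projection of the lattice is the restriction of a linear map G on R^d. This is
    what makes the projection kill the real span of the face. *)
Lemma factor_through_A : exists G : 'M[R]_(k, d), G *m Ar = map_mx intr (Q *m S).
Proof.
have : (map_mx intr (Q *m S) <= (map_mx intr A : 'M[rat]_(d, n)))%MS.
  rewrite submxE; apply/eqP/matrixP => i j.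
  have := @rat_ker (col j (cokermx (map_mx intr A))).
  rewrite colE mulmxA mulmx_coker mul0mx mulmxA -!colE => /(_ erefl) /matrixP/(_ i 0).
  by rewrite !mxE.
case/submxP => G GA; exists (map_mx ratr G).
by rewrite !(map_intr_ratr R) GA map_mxM.
Qed.

Lemma Zspan_polytope x : Zspan A P x <-> exists z, x = A *m z.
Proof.
rewrite /Zspan /= cols_on_polytope; split=> [[z ->]|[z ->]].
  exists (\col_i z i); rewrite mulmx_sum_col; apply: eq_big => [i|i _].
    by rewrite finset.in_setT.
  by rewrite mxE.
exists (fun i => z i 0); rewrite mulmx_sum_col.
by apply: eq_bigl => i; rewrite finset.in_setT.
Qed.

Lemma int_restr_eq0 (z : 'cV[int]_n) :
  S *m z = 0 <-> (forall i, i \in cols_off A beta -> z i 0 = 0).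
Proof. by rewrite -restr_eq0 map_mx_intz. Qed.

Lemma Zspan_face x : Zspan A beta x <-> exists2 z, S *m z = 0 & x = A *m z.
Proof.
split=> [[z ->]|[z /int_restr_eq0 z0 ->]].
  exists (\col_i (if i \in cols_on A beta then z i else 0)).
    by apply/int_restr_eq0 => i; rewrite inE mxE => /negbTE ->.
  rewrite mulmx_sum_col [LHS]big_mkcond; apply: eq_bigr => i _; rewrite mxE.
  by case: ifP; rewrite ?scale0r.
exists (fun i => z i 0); rewrite mulmx_sum_col [RHS]big_mkcond; apply: eq_bigr => i _.
by case: ifPn => // i_off; rewrite z0 ?scale0r // inE.
Qed.

(** If Q S z = 0 then the restriction of z is a multiple m l, and g z - B w with v.w = m
    is supported on the face; so g A z is in the span of the face. The converse uses the
    linear map G of [factor_through_A]. *)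
Lemma Zspan_satP (z : 'cV[int]_n) :
  Zspan_sat A P beta (A *m z) <-> Q *m S *m z = 0.
Proof.
split=> [[_ [m [p [c [bp xE]]]]]|Qz].
  have [G GA] := factor_through_A.
  have Gp j : G *m p j = 0.
    have [t [_ toff ->]] := face_point beta_face (bp j).
    rewrite mulmxA GA map_mxM -mulmxA (_ : map_mx intr S *m t = 0) ?mulmx0 //.
    exact/restr_eq0.
  have : G *m real_vec R (A *m z) = 0.
    rewrite xE mulmx_sumr big1 // => j _; by rewrite -scalemxAr Gp scaler0.
  rewrite /real_vec map_mxM mulmxA GA -map_mxM => /matrixP E.
  apply/matrixP => i j; have := E i j; rewrite !mxE => /eqP.
  by rewrite intr_eq0 => /eqP.
split; first by apply/Zspan_polytope; exists z.
have [i0 i0on] := face_cols_on beta_face.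
pose m := (rho *m (S *m z)) 0 0.
have Sz : S *m z = m *: l by apply: unimodular_ker; rewrite // mulmxA.
pose z' := g *: z - B *m (m *: w1).
have Sz' : S *m z' = 0.
  rewrite mulmxBr -scalemxAr Sz mulmxA SB -!scalemxAr -scalemxAl -mulmxA vw1 mulmx1.
  by rewrite !scalerA mulrC subrr.
have Az' : A *m z' = g *: (A *m z).
  by rewrite mulmxBr -scalemxAr mulmxA gale_mul0 mul0mx subr0.
exists n, (fun i => real_vec R (col (if i \in cols_on A beta then i else i0) A)),
  (fun i => (z' i 0)%:~R / g%:~R); split.
  by move=> j; apply/asboolP; rewrite -in_cols_on; case: ifP.
have gN : g%:~R != 0 :> R by rewrite intr_eq0 gt_eqF.
apply: (scalerI gN).
have -> : g%:~R *: real_vec R (A *m z) = real_vec R (A *m z').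
  by rewrite Az' /real_vec; apply/matrixP => i j; rewrite !mxE intrM.
rewrite mulmx_sum_col /real_vec raddf_sum scaler_sumr; apply: eq_bigr => i _.
rewrite scalerA mulrC divfK //.
apply: etrans (map_mxZ _ _ _) _.
move/int_restr_eq0: Sz' => z'0; case: ifPn => [//|i_off].
have -> : z' i 0 = 0 by apply: z'0; rewrite inE i_off.
by rewrite rmorph0 !scale0r.
Qed.

Lemma quotient_map_exists : exists f : 'cV[int]_d -> 'cV[int]_k,
  is_quotient_map (Zspan A P) (Zspan_sat A P beta) f.
Proof.
pose im (x : 'cV[int]_d) : set 'cV[int]_k :=
  [set y | exists2 z, x = A *m z & y = Q *m S *m z].
pose f (x : 'cV[int]_d) : 'cV[int]_k := xget 0 (im x).
have fA z : f (A *m z) = Q *m S *m z.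
  rewrite /f; have [|z' zz' ->] := @xgetPex _ 0 (im (A *m z)).
    by exists (Q *m S *m z), z.
  have [w zw] : exists w, z - z' = B *m w by apply/(proj1 galeB); rewrite mulmxBr zz' subrr.
  by apply/eqP; rewrite eq_sym -subr_eq0 -mulmxBr zw mulmxA QS_gale_mul0 mul0mx.
exists f; split.
- move=> _ _ /Zspan_polytope[x ->] /Zspan_polytope[y ->].
  by rewrite -mulmxDr !fA mulmxDr.
- apply/seteqP; split=> // y _; exists (A *m (S^T *m (W *m (col_mx (0 : 'cV_1) y)))).
    by apply/Zspan_polytope; eexists.
  rewrite fA -!mulmxA (mulmxA S) restr_ext mul1mx /Q mul_dsub_mx mulmxA VW mul1mx.
  by rewrite col_mxKd.
- by move=> _ /Zspan_polytope[z ->]; rewrite fA Zspan_satP.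
Qed.

Section QuotientMatrix.
Variable f : 'cV[int]_d -> 'cV[int]_k.
Hypothesis fP : is_quotient_map (Zspan A P) (Zspan_sat A P beta) f.

Definition quotient_matrix : 'M[int]_(k, 1 + k) :=
  \matrix_(i, j) f (col (sigma j) A) i 0.
Local Notation E := quotient_matrix.

Let f_additive x y : f (A *m (x + y)) = f (A *m x) + f (A *m y).
Proof. by have [fD _ _] := fP; rewrite mulmxDr fD //; apply/Zspan_polytope; eexists. Qed.

Let f_eq0 z : f (A *m z) = 0 <-> Q *m S *m z = 0.
Proof.
have [_ _ fK] := fP; rewrite -Zspan_satP; apply: fK.
by apply/Zspan_polytope; eexists.
Qed.

(** z and the extension by 0 of its restriction differ by a vector supported on the
    face, which f kills. *)
Lemma quotient_matrixE z : f (A *m z) = E *m (S *m z).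
Proof.
have -> : f (A *m z) = f (A *m (S^T *m (S *m z))).
  have z0 : f (A *m (z - S^T *m (S *m z))) = 0.
    by apply/f_eq0; rewrite -mulmxA mulmxBr (mulmxA S) restr_ext mul1mx subrr mulmx0.
  by rewrite -{1}[z](subrK (S^T *m (S *m z))) f_additive z0 add0r.
rewrite (additive_matrix (f := fun c : 'cV[int]_(1 + k) => f (A *m (S^T *m c)))); last first.
  by move=> x y; rewrite mulmxDr f_additive.
congr (_ *m _); apply/matrixP => i j; rewrite !mxE -colE; congr (f _ _ _).
rewrite (_ : col j S^T = delta_mx (sigma j) 0) -?colE //.
by apply/matrixP => p q; rewrite ord1 !mxE eqxx andbT eq_sym.
Qed.

Let quotient_matrix_ext c : E *m c = f (A *m (S^T *m c)).
Proof. by rewrite quotient_matrixE (mulmxA S) restr_ext mul1mx. Qed.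

Lemma quotient_matrix_eq0 (c : 'cV[int]_(1 + k)) : E *m c = 0 <-> Q *m c = 0.
Proof. by rewrite quotient_matrix_ext f_eq0 -mulmxA (mulmxA S) restr_ext mul1mx. Qed.

Lemma quotient_matrix_l : E *m l = 0.
Proof. by apply/quotient_matrix_eq0; exact: (proj2 unimodular_dual). Qed.

(** E is surjective and kills l, on which rho is 1, so adjoining the row rho gives a
    unimodular matrix; its cofactors along rho are the entries of l up to sign. *)
Lemma quotient_minors i : `|\det (col' i E)| = `|l i 0|.
Proof.
have El := quotient_matrix_l; have rl := proj1 unimodular_dual.
have /(congr1 Num.norm) := cofactor_kernel El rl i.
rewrite !normrM normrX normrN1 expr1n mul1r => <-.
rewrite surjective_det_unit ?mul1r // => y.
have [_ fS _] := fP.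
have [_ /Zspan_polytope[z ->] fz] : (f @` Zspan A P) (dsubmx y) by rewrite fS.
exists (S *m z + (usubmx y - rho *m (S *m z)) 0 0 *: l).
rewrite mul_col_mx !mulmxDr -!scalemxAr El rl scaler0 addr0 -quotient_matrixE fz.
rewrite -[RHS]vsubmxK; congr col_mx.
by apply/matrixP => p q; rewrite !ord1 !mxE eqxx mulr1 addrC subrK.
Qed.

Lemma quotient_col_off i : i \in cols_off A beta ->
  exists j, i = sigma j /\ f (col i A) = col j E.
Proof.
rewrite sigma_off => /codomP[j ->]; exists j; split=> //.
by apply/matrixP => p q; rewrite ord1 !mxE.
Qed.

Lemma quotient_col_on i : i \in cols_on A beta -> f (col i A) = 0.
Proof.
move=> ion; rewrite colE; apply/f_eq0; rewrite -mulmxA (_ : S *m _ = 0) ?mulmx0 //.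
apply/int_restr_eq0 => q; rewrite inE mxE andbT; case: eqVneq => // ->.
by rewrite ion.
Qed.
End QuotientMatrix.

(** Representatives of the cosets are the images of m l, extended by 0, for 0 <= m < g:
    modulo the image of B, multiples of l are identified when they differ by a multiple
    of g l. *)
Lemma face_index_eq : face_index A P beta = `|g|%N.
Proof.
pose r (m : nat) : 'cV[int]_d := A *m (S^T *m (m%:Z *: l)).
pose C (m : nat) := [set r m + y | y in Zspan A beta].
have rK m : Zspan_sat A P beta (r m).
  apply/Zspan_satP; rewrite -mulmxA (mulmxA S) restr_ext mul1mx.
  by rewrite -scalemxAr (proj2 unimodular_dual) scaler0.
have memC m x : C m x <-> exists2 z, S *m z = m%:Z *: l & x = A *m z.
  split=> [[_ /Zspan_face[z Sz ->] <-]|[z Sz ->]].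
    exists (S^T *m (m%:Z *: l) + z); last by rewrite mulmxDr.
    by rewrite mulmxDr Sz addr0 mulmxA restr_ext mul1mx.
  exists (A *m (z - S^T *m (m%:Z *: l))); last by rewrite mulmxBr addrC subrK.
  apply/Zspan_face; exists (z - S^T *m (m%:Z *: l)) => //.
  by rewrite mulmxBr Sz mulmxA restr_ext mul1mx subrr.
have gE : (`|g|%N : int) = g by rewrite gtz0_abs.
rewrite /face_index /lattice_index; apply: card_fset_set.
have -> : cosets (Zspan_sat A P beta) (Zspan A beta) = C @` `I_`|g|%N.
  apply/seteqP; split=> D.
    case=> x Kx ->; have [/Zspan_polytope[z zE] _] := Kx; move: Kx; rewrite {}zE {x}.
    move=> /Zspan_satP; rewrite -mulmxA => Qz.
    have Sz : S *m z = (rho *m (S *m z)) 0 0 *: l by exact: unimodular_ker.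
    set m := (_ *m _) 0 0 in Sz; pose q := (m %/ g)%Z; pose s := (m %% g)%Z.
    have s0 : 0 <= s by rewrite modz_ge0 // gt_eqF.
    have sg : s < g by rewrite ltz_pmod.
    exists `|s|%N; first by rewrite /= -ltz_nat gE gez0_abs.
    have mE : m = q * g + s := divz_eq m g.
    have Bq : S *m (B *m (q *: w1)) = (q * g) *: l.
      by rewrite mulmxA SB -scalemxAr -scalemxAl -mulmxA vw1 mulmx1 scalerA.
    have A0 : A *m (B *m (q *: w1)) = 0 by rewrite mulmxA gale_mul0 mul0mx.
    apply/seteqP; split=> y.
      move/memC => [z' Sz' ->]; rewrite gez0_abs // in Sz'.
      exists (A *m (z' + B *m (q *: w1) - z)); last by rewrite addrC mulmxBr subrK mulmxDr A0 addr0.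
      apply/Zspan_face; exists (z' + B *m (q *: w1) - z) => //.
      by rewrite mulmxBr mulmxDr Sz' Bq Sz mE -scalerDl [s + _]addrC subrr.
    case=> _ /Zspan_face[z' Sz' ->] <-; apply/memC.
    exists (z - B *m (q *: w1) + z'); last by rewrite mulmxDr mulmxBr A0 subr0.
    by rewrite mulmxDr Sz' addr0 mulmxBr Sz Bq mE -scalerBl addrC addKr gez0_abs.
  case=> m _ <-; exists (r m) => //; exact: rK.
apply: inj_card_eq => m m' /[!inE] /= mg mg' CC.
have : C m (r m).
  apply/memC; exists (S^T *m (m%:Z *: l)) => //.
  by rewrite mulmxA restr_ext mul1mx.
rewrite CC => /memC[z' Sz' /eqP]; rewrite -subr_eq0 -mulmxBr => /eqP.
move=> /(proj1 galeB)[w wE].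
have := congr1 (mulmx S) wE.
rewrite mulmxBr Sz' (mulmxA S S^T) restr_ext mul1mx mulmxA SB -scalerBl -scalemxAl -mulmxA.
move=> /(congr1 (mulmx rho)).
rewrite -!scalemxAr (mulmxA rho) (proj1 unimodular_dual) mul1mx => /matrixP/(_ 0 0).
rewrite !mxE eqxx mulr1 => E.
have : (m%:Z = m'%:Z %[mod g])%Z by apply/eqP; rewrite eqz_mod_dvd E dvdz_mulr.
rewrite !modz_small ?lez_nat //=; first by case.
  by rewrite -gE ltz_nat.
by rewrite -gE ltz_nat.
Qed.
End Lattice.

(** * Codimension of a face *)

Section Dimension.
Variables (R : realType) (d n : nat) (A : 'M[int]_(d, n)).
Local Notation Ar := (map_mx intr A : 'M[R]_(d, n)).
Local Notation P := (polytope R A).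

Definition col_span (F : set 'cV[R]_d) : 'M[R]_d :=
  (\sum_(i in cols_on A F) <<(col i Ar)^T>>)%MS.

(** The height form h is 1 on all columns, so it vanishes on their differences and
    adding one column to the span of the differences raises the dimension by one. *)
Lemma face_dimS (h : 'rV[R]_d) (F : set 'cV[R]_d) i0 :
  h *m Ar = const_mx 1 -> i0 \in cols_on A F ->
  (face_dim A F).+1 = \rank (col_span F).
Proof.
move=> hA i0F; rewrite /face_dim; set D := (X in \rank X).
pose U := (col i0 Ar)^T.
have h1 i : (col i Ar)^T *m h^T = 1%:M.
  rewrite -trmx_mul colE mulmxA hA -colE; apply/matrixP => p q.
  by rewrite !ord1 !mxE eqxx.
have U0 : U != 0.
  apply/eqP => U0; have := h1 i0; rewrite -/U U0 mul0mx => /matrixP/(_ 0 0).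
  by rewrite !mxE eqxx => /eqP; rewrite eq_sym oner_eq0.
have DE i j : (real_vec R (col i A - col j A))^T = (col i Ar)^T - (col j Ar)^T.
  by rewrite -!real_vec_col /real_vec map_mxB raddfB.
have colF i : i \in cols_on A F -> ((col i Ar)^T <= col_span F)%MS.
  by move=> iF; apply: (sumsmx_sup i) => //; rewrite genmxE.
have -> : \rank (col_span F) = \rank (D + U)%MS.
  apply/eqmx_rank/andP; split.
    apply/sumsmx_subP => i iF; rewrite genmxE -[X in (X <= _)%MS](subrK U).
    apply: addmx_sub; last exact: addsmxSr.
    apply: submx_trans (addsmxSl _ _); rewrite -DE.
    by apply: (sumsmx_sup i) => //; apply: (sumsmx_sup i0) => //; rewrite genmxE.
  rewrite addsmx_sub colF // andbT.
  apply/sumsmx_subP => i iF; apply/sumsmx_subP => j jF; rewrite genmxE DE.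
  by apply: addmx_sub; rewrite ?eqmx_opp colF.
rewrite mxrank_disjoint_sum ?rank_rV ?U0 ?addn1 //.
apply/eqP; rewrite -submx0; apply/rV_subP => x; rewrite sub_capmx => /andP[xD].
move=> /sub_rVP[a xU]; have : (D <= kermx h^T)%MS.
  apply/sumsmx_subP => i iF; apply/sumsmx_subP => j jF; rewrite genmxE DE.
  by apply/sub_kermxP; rewrite mulmxBl !h1 subrr.
move=> /(submx_trans xD)/sub_kermxP; rewrite xU -scalemxAl h1 => /matrixP/(_ 0 0).
by rewrite !mxE eqxx mulr1 => ->; rewrite scale0r sub0mx.
Qed.

Hypothesis A_rank : \rank (map_mx intr A : 'M[rat]_(d, n)) = d.

Lemma real_rank : \rank Ar = d.
Proof. by rewrite map_intr_ratr mxrank_map. Qed.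

Lemma col_span_polytope : \rank (col_span P) = d.
Proof.
rewrite -[RHS]real_rank -[RHS]mxrank_tr; apply/eqmx_rank/andP; split.
  by apply/sumsmx_subP => i _; rewrite genmxE tr_col row_sub.
apply/row_subP => i; apply: (sumsmx_sup i); last by rewrite genmxE tr_col.
by rewrite cols_on_polytope finset.in_setT.
Qed.

Hypothesis A_ones : ((const_mx 1 : 'rV[rat]_n) <= map_mx intr A)%MS.

Lemma height_form : exists h : 'rV[R]_d, h *m Ar = const_mx 1.
Proof.
have [h hA] := submxP A_ones; exists (map_mx ratr h).
by rewrite map_intr_ratr -map_mxM -hA; apply/matrixP => i j; rewrite !mxE rmorph1.
Qed.

Variables (B : 'M[int]_(n, 2)).
Hypothesis galeB : is_gale_dual A B.
Variables (beta : set 'cV[R]_d) (beta_face : is_face A beta).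
Variables (k : nat) (sigma : 'I_(1 + k) -> 'I_n).
Hypothesis sigma_inj : injective sigma.
Hypothesis sigma_off : forall i, (i \in cols_off A beta) = (i \in codom sigma).
Variables (V W : 'M[int]_(1 + k)) (g : int) (v : 'rV[int]_2) (w1 : 'cV[int]_2).
Hypotheses (VW : V *m W = 1%:M) (WV : W *m V = 1%:M) (g_gt0 : 0 < g).
Hypothesis vw1 : v *m w1 = 1%:M.
Let S : 'M[int]_(1 + k, n) := rowsub sigma 1%:M.
Hypothesis SB : S *m B = g *: (col 0 W *m v).

Local Notation toR := (map_mx intr).

(** The span of the face is the kernel of the surjection G of [factor_through_A]. *)
Lemma col_span_face : \rank (col_span beta) = (d - k)%N.
Proof.
have [G GA] := @factor_through_A R _ _ _ _ galeB _ sigma _ _ _ _ VW SB.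
have Grank : \rank G = k.
  apply/eqP; rewrite eqn_leq rank_leq_row /=.
  have {1}<- : \rank (G *m (Ar *m toR (S^T *m (W *m (@col_mx _ 1 k k 0 1%:M))))) = k.
    rewrite mulmxA GA -map_mxM -!mulmxA (mulmxA S) restr_ext // mul1mx.
    by rewrite mul_dsub_mx mulmxA VW mul1mx col_mxKd map_mx1 mxrank1.
  exact: mxrankM_maxl.
have -> : \rank (col_span beta) = \rank (kermx G^T).
  apply/eqmx_rank/andP; split.
    apply/sumsmx_subP => i iF; rewrite genmxE; apply/sub_kermxP.
    rewrite -trmx_mul colE mulmxA GA map_mxM -mulmxA (_ : toR S *m _ = 0) ?mulmx0 ?trmx0 //.
    apply/(restr_eq0 sigma_off) => q; rewrite inE mxE andbT; case: eqVneq => // ->.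
    by rewrite iF.
  apply/rV_subP => x /sub_kermxP xG.
  have /submxP[z xz] : (x <= Ar^T)%MS.
    apply: submx_full; rewrite /row_full mxrank_tr real_rank //.
  have QSz : dsubmx (toR V) *m (toR S *m z^T) = 0.
    rewrite -map_dsubmx mulmxA -map_mxM -GA; apply: trmx_inj.
    by rewrite !trmx_mul trmxK trmx0 mulmxA -xz xG.
  have WVr : toR W *m toR V = 1%:M :> 'M[R]_(1 + k) by rewrite -map_mxM WV map_mx1.
  have Sz := unimodular_ker WVr QSz; set m := (_ *m _) 0 0 in Sz.
  have gN : g%:~R != 0 :> R by rewrite intr_eq0 gt_eqF.
  pose z' := z^T - toR B *m ((m / g%:~R) *: toR w1).
  have Sz' : toR S *m z' = 0.
    rewrite mulmxBr Sz mulmxA -map_mxM SB map_mxZ map_mxM -!scalemxAr -!scalemxAl -mulmxA.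
    by rewrite -map_mxM vw1 map_mx1 mulmx1 scalerA divfK // map_col subrr.
  have xz' : x^T = Ar *m z'.
    rewrite mulmxBr mulmxA -map_mxM (gale_mul0 galeB) map_mx0 mul0mx subr0.
    by rewrite xz trmx_mul trmxK.
  rewrite -[x]trmxK xz' mulmx_sum_col raddf_sum; apply: summx_sub => i _.
  rewrite [X in (X <= _)%MS](_ : _ = z' i 0 *: (col i Ar)^T); last exact: linearZ.
  have [iF|iF] := boolP (i \in cols_on A beta).
    by apply: scalemx_sub; apply: (sumsmx_sup i) => //; rewrite genmxE.
  move/(restr_eq0 sigma_off): Sz' => ->; last by rewrite inE.
  by rewrite scale0r sub0mx.
by rewrite mxrank_ker mxrank_tr Grank.
Qed.

(** The spans of the polytope and of the face have dimensions d and d - k, in both cases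
    one more than the affine dimension. *)
Lemma face_codim : (face_dim A P - face_dim A beta)%N = k.
Proof.
have [h hA] := height_form; have [i0 i0on] := face_cols_on beta_face.
have i0P : i0 \in cols_on A P by rewrite cols_on_polytope finset.in_setT.
have := face_dimS hA i0on; have := face_dimS hA i0P.
rewrite col_span_polytope col_span_face; lia.
Qed.
End Dimension.

(** * The circuit attached to a face *)

(** The Bezout coefficients are the entries of rho. *)
Lemma gcd_multiples k (l : 'cV[int]_k) (rho : 'rV[int]_k) (g : int) :
  rho *m l = 1%:M -> (\big[gcdn/0]_j `|(g * l j 0)%R|)%N = `|g|%N.
Proof.
move=> rl; apply/eqP; rewrite eqn_dvd; apply/andP; split; last first.
  by apply/dvdn_biggcdP => j _; rewrite abszM dvdn_mulr.
set D := \big[_/_]_j _.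
have gE : g = \sum_j rho 0 j * (g * l j 0).
  move/matrixP/(_ 0 0): rl; rewrite !mxE eqxx mulr1n => rl.
  rewrite -[LHS]mulr1 -rl mulr_sumr; apply: eq_bigr => j _; ring.
have : (D%:Z %| g)%Z.
  rewrite gE; apply: rpred_sum => j _; apply: dvdz_mull.
  by rewrite /dvdz /= -/D; apply: (dvdn_biggcdP _ _ _ (dvdnn _)).
by [].
Qed.

Section EnumOff.
Variables (n k : nat) (I : {set 'I_n}) (cardI : #|I| = (1 + k)%N).

Definition enum_off (j : 'I_(1 + k)) : 'I_n := enum_val (cast_ord (esym cardI) j).

Lemma enum_off_inj : injective enum_off.
Proof. by move=> i j /enum_val_inj/cast_ord_inj. Qed.

Lemma mem_enum_off i : (i \in I) = (i \in codom enum_off).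
Proof.
apply/idP/codomP => [iI|[j ->]]; last exact: enum_valP.
exists (cast_ord cardI (enum_rank_in iI i)).
by rewrite /enum_off cast_ordK enum_rankK_in.
Qed.

Lemma big_enum_off (T : Type) (idx : T) (op : Monoid.com_law idx) (Pr : pred 'I_n)
    (F : 'I_n -> T) :
  \big[op/idx]_(i in I | Pr i) F i =
  \big[op/idx]_(j | Pr (enum_off j)) F (enum_off j).
Proof.
rewrite big_enum_val_cond (reindex (cast_ord (esym cardI))) //.
by exists (cast_ord cardI) => j _; rewrite ?cast_ordK ?cast_ordKV.
Qed.
End EnumOff.

Section FaceCircuit.
Variables (R : realType) (d n : nat) (A : 'M[int]_(d, n)) (B : 'M[int]_(n, 2)).
Hypothesis A_rank : \rank (map_mx intr A : 'M[rat]_(d, n)) = d.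
Hypothesis A_ones : ((const_mx 1 : 'rV[rat]_n) <= map_mx intr A)%MS.
Hypothesis galeB : is_gale_dual A B.
Variables (beta : set 'cV[R]_d) (beta_face : is_face A beta).
Variables (k : nat) (cardI : #|cols_off A beta| = (1 + k)%N).
Let sigma := enum_off cardI.
Variables (V W : 'M[int]_(1 + k)) (g : int) (v : 'rV[int]_2) (w1 : 'cV[int]_2).
Hypotheses (VW : V *m W = 1%:M) (WV : W *m V = 1%:M) (g_gt0 : 0 < g).
Hypothesis vw1 : v *m w1 = 1%:M.
Let l : 'cV[int]_(1 + k) := col 0 W.
Hypothesis SB : rowsub sigma 1%:M *m B = g *: (l *m v).
Let sigma_inj : injective sigma. Proof. exact: enum_off_inj. Qed.
Let sigma_off : forall i, (i \in cols_off A beta) = (i \in codom sigma).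
Proof. exact: mem_enum_off. Qed.
Hypothesis l_neq0 : forall j, l j 0 != 0.

Local Notation P := (polytope R A).
Local Notation toR := (map_mx intr).
Local Notation lr := (map_mx intr l : 'cV[R]_(1 + k)).

(** The slack vector w of the face satisfies w B = 0, since the constant vector and the
    rows of A are orthogonal to the columns of B; it is supported on the columns off the
    face and positive there. *)
Lemma positive_relation : exists2 w : 'I_(1 + k) -> R,
  forall j, 0 < w j & \sum_j w j * (l j 0)%:~R = 0.
Proof.
have [h hA] := height_form R A_ones.
have [u [c [w0 won _]]] := face_slack beta_face; set w := _ - _ in w0 won.
have wB : w *m toR B = 0.
  rewrite mulmxBl -mulmxA -map_mxM (gale_mul0 galeB) map_mx0 mulmx0 subr0.
  have -> : const_mx c = c *: (h *m toR A) :> 'rV[R]_n.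
    by rewrite hA; apply/matrixP => i j; rewrite !mxE mulr1.
  by rewrite -scalemxAl -mulmxA -map_mxM (gale_mul0 galeB) map_mx0 mulmx0 scaler0.
exists (fun j => w 0 (sigma j)).
  move=> j; rewrite lt_neqAle w0 andbT eq_sym won.
  by have : sigma j \in cols_off A beta by [rewrite (mem_enum_off cardI) codom_f]; rewrite inE.
have gN : g%:~R != 0 :> R by rewrite intr_eq0 gt_eqF.
apply: (mulfI gN); rewrite mulr0 mulr_sumr.
have [b bE] : exists b, b = B *m w1 by exists (B *m w1).
have bl j : b (sigma j) 0 = g * l j 0.
  have /(congr1 (mulmx^~ w1)) := SB; rewrite -scalemxAl -!mulmxA vw1 mulmx1 -bE.
  by move=> /matrixP/(_ j 0); rewrite mul_rowsub_mx mul1mx mxE [RHS]mxE.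
have /matrixP/(_ 0 0) : w *m toR b = 0 by rewrite bE map_mxM mulmxA wB mul0mx.
rewrite !mxE (bigID (fun i => i \in cols_off A beta)) /= [X in _ + X]big1 ?addr0; last first.
  by move=> i; rewrite inE negbK -won => /eqP ->; rewrite mul0r.
rewrite (eq_bigl (fun i => (i \in cols_off A beta) && true)); last by move=> i; rewrite andbT.
rewrite (big_enum_off cardI) /= => E; rewrite -[RHS]E; apply: eq_bigr => j _.
by rewrite mulrCA !mxE bl intrM !mxE.
Qed.

(** Otherwise all the terms of the positive relation have the same sign. *)
Lemma circuit_signs : (exists j, lr j 0 < 0) /\ (exists j, 0 < lr j 0).
Proof.
have [w w0 wl] := positive_relation.
have lr0 j : lr j 0 != 0 by rewrite mxE intr_eq0.
have pos (s : R) : s != 0 -> exists j, 0 < s * lr j 0.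
  move=> s0; apply/existsP; apply: contra_eqT wl => /existsPn ln.
  have sl j : 0 <= w j * - (s * lr j 0).
    by apply: mulr_ge0; [exact/ltW/w0|rewrite oppr_ge0 leNgt ln].
  apply/eqP => wl; have : \sum_j w j * - (s * lr j 0) = 0.
    transitivity (- s * \sum_j w j * (l j 0)%:~R); last by rewrite wl mulr0.
    rewrite mulr_sumr; apply: eq_bigr => j _.
    by rewrite !mxE; ring.
  move=> /eqP; rewrite psumr_eq0 // => /allP/(_ 0 (mem_index_enum _)).
  by rewrite mulf_eq0 oppr_eq0 mulf_eq0 (negbTE s0) (negbTE (lr0 0)) gt_eqF.
have N1 : -1 != 0 :> R by rewrite oppr_eq0 oner_eq0.
have [[j1 H1] [j2 H2]] := (pos _ (oner_neq0 R), pos _ N1).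
by split; [exists j2; rewrite -oppr_gt0 -mulN1r|exists j1; rewrite -[lr j1 0]mul1r].
Qed.

(** The image of the configuration is 0 together with the columns of the quotient
    matrix. These columns are nonzero because l has no zero entry and at least two
    entries. *)
Lemma subdiagram_volume_circuit :
  let S (s : int) := (\sum_(j | (0 < s * l j 0)%R) `|l j 0%R|)%N in
  subdiagram_volume A P beta = (minn (S 1) (S (-1)))%:R.
Proof.
move=> S; rewrite /subdiagram_volume /quotient_config.
have -> : (face_dim A P - face_dim A beta)%N = k.
  exact: (face_codim A_rank A_ones galeB beta_face sigma_inj sigma_off VW WV g_gt0 vw1 SB).
have fP := xgetPex (fun=> 0)
  (quotient_map_exists galeB beta_face sigma_inj sigma_off VW WV g_gt0 vw1 SB).
rewrite -/(quotient_map _ _ _) in fP *.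
set f := quotient_map _ _ _ in fP *.
pose E := quotient_matrix A sigma f; pose Er : 'M[R]_(k, k.+1) := toR E.
have ElR : Er *m lr = 0.
  rewrite -map_mxM (quotient_matrix_l galeB beta_face sigma_inj sigma_off VW WV g_gt0 vw1 SB fP).
  by rewrite map_mx0.
have detE i : `|\det (col' i Er)| = `|lr i 0|.
  rewrite -map_col' det_map_mx mxE -!intr_norm.
  by rewrite (quotient_minors galeB beta_face sigma_inj sigma_off VW WV g_gt0 vw1 SB fP).
have lr0 i : lr i 0 != 0 by rewrite mxE intr_eq0.
have [lrN lrP] := circuit_signs.
have col_neq0 j : col j Er <> 0.
  move=> Ej; have [|s sE] := circuit_ker lr0 ElR detE (c := delta_mx j 0).
    by rewrite -colE.
  have s0 : s != 0.
    apply/eqP => s0; have /matrixP/(_ j 0) := sE; rewrite s0 scale0r !mxE !eqxx => /eqP.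
    by rewrite oner_eq0.
  have only i : i = j.
    apply/eqP/negPn/negP => ij; have /matrixP/(_ i 0)/esym := sE.
    rewrite [LHS]mxE [RHS]mxE (negbTE ij) => /eqP.
    by rewrite mulf_eq0 (negbTE s0) (negbTE (lr0 i)).
  have [[i1 H1] [i2 H2]] := (lrN, lrP).
  by move: H1 H2; rewrite (only i1) (only i2) => H1 H2; have := lt_trans H1 H2; rewrite ltxx.
pose cols := [set x : 'cV[R]_k | exists j, x = col j Er].
have configE : [set y | exists2 i, i \in cols_on A P & y = real_vec R (f (col i A))] =
    cols `|` [set 0].
  apply/seteqP; split=> y.
    case=> i _ ->; have [ion|ioff] := boolP (i \in cols_on A beta).
      right; rewrite (quotient_col_on galeB beta_face sigma_off VW WV g_gt0 vw1 SB fP ion).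
      by rewrite /real_vec map_mx0.
    left; have [|j [_ ->]] := @quotient_col_off _ _ _ A beta k sigma sigma_off f i.
      by rewrite inE.
    by exists j; rewrite /real_vec map_col.
  case=> [[j ->]|->].
    exists (sigma j); first by rewrite cols_on_polytope finset.in_setT.
    by apply/matrixP => p q; rewrite ord1 !mxE.
  have [i0 i0on] := face_cols_on beta_face; exists i0.
    by rewrite cols_on_polytope finset.in_setT.
  rewrite (quotient_col_on galeB beta_face sigma_off VW WV g_gt0 vw1 SB fP i0on).
  by rewrite /real_vec map_mx0.
rewrite configE (_ : (cols `|` [set 0]) `\ 0 = cols); last first.
  apply/seteqP; split=> y; first by case=> -[].
  by move=> [j yj]; split; [left; exists j|move=> /= y0; apply: (col_neq0 j); rewrite -yj].
rewrite (circuit_volume lr0 ElR detE lrN lrP).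
have sumE s (Pr : pred 'I_(1 + k)) : (forall i, Pr i = (0 < s * l i 0)) ->
    \sum_(i | Pr i) `|lr i 0| = (S s)%:R.
  move=> PrE; rewrite natr_sum; apply: eq_big => // i _.
  by rewrite mxE -intr_norm -abszE.
rewrite (sumE 1) ?(sumE (-1)).
- rewrite /Order.min ltr_nat /minn; by case: ifP.
- by move=> i; rewrite mxE ltrz0 mulN1r oppr_gt0.
- by move=> i; rewrite mxE ltr0z mul1r.
Qed.
End FaceCircuit.

Theorem theorem3p2 (R : realType) (d : nat)
    (A : 'M[int]_(d, d.+2)) (B : 'M[int]_(d.+2, 2))
    (A_rank : \rank (map_mx intr A : 'M[rat]_(d, d.+2)) = d)
    (A_ones : ((const_mx 1 : 'rV[rat]_(d.+2)) <= map_mx intr A)%MS)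
    (galeB : is_gale_dual A B)
    (B_neq0 : forall i : 'I_(d.+2), row i B != 0)
    (beta : set 'cV[R]_d)
    (beta_face : is_face A beta)
    (beta_proper : beta <> polytope R A)
    (r : nat)
    (beta_codim : face_dim A (polytope R A) = (face_dim A beta + r)%N)
    (ell : set 'rV[R]_2)
    (ell_relevant : relevant_line B ell)
    (B_beta_ell : forall i : 'I_(d.+2),
        i \in cols_off A beta -> ell (real_row R B i))
    (v : 'rV[int]_2)
    (v_primitive : primitive_vec v)
    (v_ell : ell (map_mx intr v))
    (lambda : 'I_(d.+2) -> int)
    (lambdaE : forall i : 'I_(d.+2),
        i \in cols_off A beta -> row i B = lambda i *: v) :
  subdiagram_volume A (polytope R A) beta =
    (minn (\sum_(i in cols_off A beta | (0 < lambda i)%R) `|lambda i|)%N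
          (\sum_(i in cols_off A beta | (lambda i < 0)%R) `|lambda i|)%N)%:R
    / (\big[gcdn/0]_(i in cols_off A beta) `|lambda i|)%N%:R
  /\
  face_index A (polytope R A) beta =
    (\big[gcdn/0]_(i in cols_off A beta) `|lambda i|)%N.
Proof.
have [w1 vw1] := primitive_pairing v_primitive.
have [i1 i1off] := face_cols_off beta_face beta_proper.
have [k cardI] : exists k, #|cols_off A beta| = (1 + k)%N.
  exists #|cols_off A beta|.-1; rewrite add1n prednK //.
  by apply/card_gt0P; exists i1.
pose sigma := enum_off cardI.
have sigma_off j : sigma j \in cols_off A beta by rewrite (mem_enum_off cardI) codom_f.
have lambda_neq0 i : i \in cols_off A beta -> lambda i != 0.
  by move=> ioff; apply: contraNneq (B_neq0 i) => li; rewrite lambdaE // li scale0r.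
pose lam : 'cV[int]_k.+1 := \col_j lambda (sigma j).
have lam0 : lam != 0.
  apply/eqP => /matrixP/(_ 0 0); rewrite !mxE => /eqP; exact/negP/lambda_neq0.
have [V [W [g [VW WV g_gt0 Vlam]]]] := unimodular_column lam0.
pose l := col 0 W.
have lamE : lam = g *: l.
  by rewrite /l colE scalemxAr -Vlam mulmxA WV mul1mx.
have lE j : lambda (sigma j) = g * l j 0.
  by have /matrixP/(_ j 0) := lamE; rewrite [LHS]mxE [RHS]mxE.
have SB : rowsub sigma 1%:M *m B = g *: (l *m v).
  rewrite mul_rowsub_mx mul1mx; apply/row_matrixP => j.
  rewrite row_rowsub lambdaE // scalemxAl -lamE.
  by apply/rowP => q; rewrite !mxE big_ord1 !mxE.
have l_neq0 j : l j 0 != 0.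
  by have := lambda_neq0 _ (sigma_off j); rewrite lE mulf_eq0 negb_or => /andP[].
have rl : usubmx V *m l = 1%:M := proj1 (unimodular_dual VW).
have gcdE : (\big[gcdn/0]_(i in cols_off A beta) `|lambda i|)%N = `|g|%N.
  rewrite (eq_bigl (fun i => (i \in cols_off A beta) && true)); last by move=> i; rewrite andbT.
  rewrite (big_enum_off cardI) -(gcd_multiples g rl) /=.
  by apply: eq_bigr => j _; rewrite -/sigma lE.
have sumE s (Pr : pred 'I_d.+2) : (forall j, Pr (sigma j) = (0 < s * l j 0)) ->
    (\sum_(i in cols_off A beta | Pr i) `|lambda i|)%N =
    (`|g| * \sum_(j | (0 < s * l j 0)%R) `|l j 0%R|)%N.
  move=> PrE; rewrite (big_enum_off cardI) big_distrr /=.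
  by apply: eq_big => j; rewrite -/sigma ?PrE // lE abszM.
split; last first.
  rewrite gcdE; exact: (face_index_eq galeB beta_face (enum_off_inj (cardI := cardI))
    (mem_enum_off cardI) VW WV g_gt0 vw1 SB).
rewrite (subdiagram_volume_circuit A_rank A_ones galeB beta_face VW WV g_gt0 vw1 SB l_neq0).
rewrite gcdE (sumE 1) ?(sumE (-1)); first 1 last.
- by move=> j; rewrite lE mulN1r oppr_gt0 pmulr_rlt0.
- by move=> j; rewrite lE mul1r pmulr_rgt0.
rewrite -minnMr natrM mulrC mulKf // pnatr_eq0 absz_eq0 gt_eqF //.
Qed.
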